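(* Let $K$ be a field of characteristic $0$ and let $\delta=\delta(p_1,\ldots,p_{s-1},0)$ be a Weitzenböck derivation of the free metabelian associative algebra $F_d$ with a $1\times 1$ Jordan cell, where $X_d=\{x_1,\ldots,x_d\}$ is a Jordan basis such that $KX_{d-1}$ is $\delta$-invariant and $\delta(x_d)=0$. Let $\delta$ act in the same way on $KU_d$ and on $KV_d$. Then the bigraded Hilbert series of $(F_d')^{\delta}$, $(F_{d-1}')^{\delta}$ and $K[U_{d-1},V_{d-1}]_{\omega}^{\delta}$ are related by \[ H_{GL_2}((F_d')^{\delta},t_1,t_2,z)=\frac{1}{(1-z)^2}\left(H_{GL_2}((F_{d-1}')^{\delta},t_1,t_2,z)+zH_{GL_2}(K[U_{d-1},V_{d-1}]_{\omega}^{\delta},t_1,t_2,z)\right), \] and the graded Hilbert series by \[ H((F_d')^{\delta},z)=\frac{1}{(1-z)^2}\left(H((F_{d-1}')^{\delta},z)+zH(K[U_{d-1},V_{d-1}]_{\omega}^{\delta},z)\right). \]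
   Context: All associative algebras are unitary over $K$. Let $A_d=K\langle x_1,\ldots,x_d\rangle$ be the free unitary associative algebra and $A_d'$ its commutator ideal. The free metabelian associative algebra is $F_d=A_d/(A_d')^2$, and $F_d'$ is its commutator ideal. $F_{d-1}$ is the analogous algebra on $X_{d-1}=\{x_1,\ldots,x_{d-1}\}$, viewed as a subalgebra of $F_d$. A Weitzenböck derivation $\delta$ of $F_d$ is a derivation acting on the vector space $KX_d$ with basis $X_d=\{x_1,\ldots,x_d\}$ as a nonzero nilpotent linear operator. It is denoted by $\delta(p_1,\ldots,p_s)$ if its Jordan cells on $KX_d$ have sizes $p_1+1\geq\cdots\geq p_s+1\geq 1$, with $\sum(p_i+1)=d$. A Jordan basis is one in which the part $x_j,x_{j+1},\ldots,x_{j+p_i}$ of $X_d$ corresponding to the $i$-th cell satisfies $\delta(x_j)=0$, $\delta(x_{j+k})=x_{j+k-1}$ for $k=1,\ldots,p_i$. Here the last cell has size $1$ and corresponds to $x_d$. If $\delta(x_j)=\sum_i\alpha_{ij}x_i$, then $\delta$ acts as a derivation on the commutative polynomial algebra $K[U_d,V_d]=K[u_1,\ldots,u_d,v_1,\ldots,v_d]$ by $\delta(u_j)=\sum_i\alpha_{ij}u_i$, $\delta(v_j)=\sum_i\alpha_{ij}v_i$. For a $\delta$-invariant subspace $W$, $W^{\delta}=\{w\in W\mid\delta(w)=0\}$. $K[U_{d-1},V_{d-1}]_{\omega}=K[U_{d-1}]\otimes_K\omega(K[V_{d-1}])$, where $\omega(K[V_{d-1}])$ is the ideal of polynomials in $K[V_{d-1}]$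 without constant term. It is identified with the ideal of $K[U_{d-1},V_{d-1}]$ generated by $v_1,\ldots,v_{d-1}$. Gradings: all of $x_j,u_j,v_j$ have total degree $1$. If $x_j,\ldots,x_{j+p_i}$ correspond to the $i$-th Jordan cell, then $x_{j+k}$, $u_{j+k}$ and $v_{j+k}$ have bidegree $(p_i-k,k)$, $k=0,\ldots,p_i$ (so $x_d,u_d,v_d$ have bidegree $(0,0)$). These extend additively to products and make $F_d'$, $F_{d-1}'$, $K[U_{d-1},V_{d-1}]_\omega$ and their subspaces of constants graded and bigraded. For such a space $W$, $H(W,z)=\sum_{n\ge 0}\dim W^{(n)}z^n$, where $W^{(n)}$ is the component of total degree $n$, and $H_{GL_2}(W,t_1,t_2,z)=\sum_{n,n_1,n_2}\dim W^{(n;n_1,n_2)}t_1^{n_1}t_2^{n_2}z^n$, where $W^{(n;n_1,n_2)}$ is the component of total degree $n$ and bidegree $(n_1,n_2)$. *)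

(* Defs.v *)
From HB Require Import structures.
From mathcomp Require Import all_boot all_order all_algebra.
From mathcomp Require Import generic_quotient ring_quotient.
From mathcomp Require Import boolp classical_sets.
From mathcomp Require Import finmap.
From mathcomp Require Import monalg.
From mathcomp Require Import mpoly.

Set Implicit Arguments.
Unset Strict Implicit.
Unset Printing Implicit Defensive.

Import GRing.Theory.

Local Open Scope classical_set_scope.
Local Open Scope ring_scope.
Local Open Scope quotient_scope.

(* Formal power series in one variable.  Iterating the construction gives
   several variables: R[[t2]][[t1]][[z]] is {fps {fps {fps R}}}. *)

Record fps (R : Type) := Fps { fpscoef : nat -> R }.

Notation "{ 'fps' R }" := (fps R) (at level 0, format "{ 'fps'  R }").

HB.instance Definition _ (R : Type) := gen_eqMixin (fps R).
HB.instance Definition _ (R : Type) := gen_choiceMixin (fps R).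

Lemma fpsP (R : Type) (f g : fps R) :
  (forall n, fpscoef f n = fpscoef g n) -> f = g.
Proof. by case: f g => f [g] /= fg; congr Fps; apply/funext. Qed.

Section FpsRing.
Variable R : comNzRingType.
Implicit Types f g h : fps R.

Definition fpsZ : fps R := Fps (fun n => (n == 1%N)%:R).
Definition fps0 : fps R := Fps (fun=> 0).
Definition fps1 : fps R := Fps (fun n => (n == 0%N)%:R).
Definition fpsN f := Fps (fun n => - fpscoef f n).
Definition fpsD f g := Fps (fun n => fpscoef f n + fpscoef g n).
Definition fpsM f g :=
  Fps (fun n => \sum_(i < n.+1) fpscoef f i * fpscoef g (n - i)%N).

Fact fpsDA : associative fpsD.
Proof. by move=> f g h; apply: fpsP => n /=; rewrite addrA. Qed.

Fact fpsDC : commutative fpsD.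
Proof. by move=> f g; apply: fpsP => n /=; rewrite addrC. Qed.

Fact fps0D : left_id fps0 fpsD.
Proof. by move=> f; apply: fpsP => n /=; rewrite add0r. Qed.

Fact fpsND : left_inverse fps0 fpsN fpsD.
Proof. by move=> f; apply: fpsP => n /=; rewrite addNr. Qed.

HB.instance Definition _ :=
  GRing.isZmodule.Build (fps R) fpsDA fpsDC fps0D fpsND.

Definition fpstrunc n f : {poly R} := \poly_(i < n.+1) fpscoef f i.

Lemma coef_fpstrunc n f i : (i <= n)%N -> (fpstrunc n f)`_i = fpscoef f i.
Proof. by move=> le_in; rewrite coef_poly ltnS le_in. Qed.

Lemma coef_fpsM n f g i : (i <= n)%N ->
  fpscoef (fpsM f g) i = (fpstrunc n f * fpstrunc n g)`_i.
Proof.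
move=> le_in; rewrite coefM /=; apply: eq_bigr => j _.
have le_ji : (j <= i)%N by rewrite -ltnS.
by rewrite !coef_fpstrunc ?(leq_trans le_ji) ?(leq_trans (leq_subr _ _)).
Qed.

Fact fpsMA : associative fpsM.
Proof.
move=> f g h; apply: fpsP => n.
have E u v (p : {poly R}) w : (forall i, (i <= n)%N -> fpscoef u i = p`_i) ->
    w = fpscoef (fpsM u v) n -> w = (p * fpstrunc n v)`_n.
  move=> up ->; rewrite coefM /=; apply: eq_bigr => j _.
  by rewrite coef_fpstrunc ?leq_subr // up // -ltnS.
have E' u v (p : {poly R}) w : (forall i, (i <= n)%N -> fpscoef u i = p`_i) ->
    w = fpscoef (fpsM v u) n -> w = (fpstrunc n v * p)`_n.
  move=> up ->; rewrite coefM /=; apply: eq_bigr => j _.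
  by rewrite coef_fpstrunc -1?ltnS // up // leq_subr.
rewrite (E' _ _ _ _ (@coef_fpsM n g h) erefl).
by rewrite (E _ _ _ _ (@coef_fpsM n f g) erefl) mulrA.
Qed.

Fact fpsMC : commutative fpsM.
Proof.
by move=> f g; apply: fpsP => n; rewrite !(@coef_fpsM n) // mulrC.
Qed.

Fact fps1M : left_id fps1 fpsM.
Proof.
move=> f; apply: fpsP => n /=; rewrite big_ord_recl /= mul1r subn0.
by rewrite big1 ?addr0 // => i _; rewrite mul0r.
Qed.

Fact fpsMDl : left_distributive fpsM fpsD.
Proof.
move=> f g h; apply: fpsP => n /=; rewrite -big_split /=.
by apply: eq_bigr => i _; rewrite mulrDl.
Qed.

Fact fps1_neq0 : fps1 != 0.
Proof.
apply/eqP => /(congr1 (fun f => fpscoef f 0%N)) /= /eqP.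
by rewrite oner_eq0.
Qed.

HB.instance Definition _ := GRing.Zmodule_isComNzRing.Build (fps R)
  fpsMA fpsMC fps1M fpsMDl fps1_neq0.

Definition fpsunit : pred (fps R) := fun f => `[< exists g, g * f = 1 >].
Definition fpsinv f := xget f [set g | g * f = 1].

Fact fpsMV : {in fpsunit, left_inverse 1 fpsinv *%R}.
Proof.
move=> f /asboolP [g gf]; rewrite /fpsinv.
by case: xgetP => [h _ //|/(_ g)].
Qed.

Fact fpsunitPl f g : g * f = 1 -> fpsunit f.
Proof. by move=> gf; apply/asboolP; exists g. Qed.

Fact fpsinv_out : {in [predC fpsunit], fpsinv =1 id}.
Proof.
move=> f /asboolPn nf; rewrite /fpsinv.
by case: xgetP => // h _ hf; case: nf; exists h.
Qed.

HB.instance Definition _ := GRing.ComNzRing_hasMulInverse.Build (fps R)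
  fpsMV fpsunitPl fpsinv_out.

Lemma fps_unit1BZ : (1 - fpsZ) \is a GRing.unit.
Proof.
suff E : Fps (fun=> 1) * (1 - fpsZ) = 1.
  by apply/asboolP; exists (Fps (fun=> 1)).
rewrite mulrC mulrBl mul1r; apply: fpsP => -[|n] /=.
  by rewrite big_ord_recl big_ord0 /= mul0r addr0 subr0.
rewrite big_ord_recl big_ord_recl /= mul0r mul1r add0r.
by rewrite big1 ?addr0 ?subrr // => i _; rewrite mul0r.
Qed.

End FpsRing.

Notation "''z'" := (fpsZ _) (at level 0).

Section Spans.
Variable K : fieldType.

Definition lspan (V : lmodType K) (S : set V) : set V :=
  [set w | exists (m : nat) (c : 'I_m -> K) (b : 'I_m -> V),
     (forall i, S (b i)) /\ w = \sum_i c i *: b i].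

Definition has_basis (V : lmodType K) (W : set V) (m : nat) : Prop :=
  exists b : 'I_m -> V,
    [/\ forall i, W (b i),
        forall c : 'I_m -> K, \sum_i c i *: b i = 0 -> forall i, c i = 0
      & forall w, W w -> exists c : 'I_m -> K, w = \sum_i c i *: b i].

(* The dimension of a finite dimensional subspace; junk value 0 otherwise. *)
Definition vdim (V : lmodType K) (W : set V) : nat := xget 0%N (has_basis W).

Variable B : algType K.

Definition ideal_gen (S : set B) : set B :=
  lspan [set z | exists a s b, S s /\ z = a * s * b].

Definition ideal_mul (I J : set B) : set B :=
  lspan [set z | exists a b, [/\ I a, J b & z = a * b]].

Definition comm_ideal : set B :=
  ideal_gen [set z | exists a b, z = a * b - b * a].

End Spans.

Arguments comm_ideal {K} B.

Section SpanTheory.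
Variable K : fieldType.

Lemma lspan0 (V : lmodType K) (S : set V) : lspan S 0.
Proof.
exists 0%N, (fun=> 0), (fun=> 0); split; first by case.
by rewrite big_ord0.
Qed.

Lemma lspanZ (V : lmodType K) (S : set V) k w : lspan S w -> lspan S (k *: w).
Proof.
case=> m [c [b [Sb ->]]]; exists m, (fun i => k * c i), b; split=> //.
by rewrite scaler_sumr; apply: eq_bigr => i _; rewrite scalerA.
Qed.

Lemma lspanD (V : lmodType K) (S : set V) v w :
  lspan S v -> lspan S w -> lspan S (v + w).
Proof.
case=> m [c [b [Sb ->]]] [n [d [e [Se ->]]]].
pose j T (f : 'I_m -> T) (g : 'I_n -> T) i :=
  match split i with inl i => f i | inr i => g i end.
exists (m + n)%N, (j _ c d), (j _ b e); split.
  by move=> i; rewrite /j; case: (split i).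
rewrite big_split_ord /=; congr (_ + _); apply: eq_bigr => i _; rewrite /j.
  by rewrite (unsplitK (inl i)).
by rewrite (unsplitK (inr i)).
Qed.

Lemma lspan_in (V : lmodType K) (S : set V) v : S v -> lspan S v.
Proof.
move=> Sv; exists 1%N, (fun=> 1), (fun=> v); split=> //.
by rewrite big_ord1 scale1r.
Qed.

Lemma lspan_ind (V : lmodType K) (S : set V) (P : set V) :
    P 0 -> (forall u v, P u -> P v -> P (u + v)) ->
    (forall k s, S s -> P (k *: s)) -> forall w, lspan S w -> P w.
Proof.
move=> P0 PD PS w [m [c [b [Sb ->]]]].
by elim/big_ind: _ => // i _; apply: PS.
Qed.

Lemma ideal_genMl (B : algType K) (S : set B) a w :
  ideal_gen S w -> ideal_gen S (a * w).
Proof.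
move: w; apply: lspan_ind.
- by rewrite mulr0; exact: lspan0.
- by move=> u v ??; rewrite mulrDr; apply: lspanD.
move=> k _ [b [s [e [Ss ->]]]]; rewrite -scalerAr; apply/lspanZ/lspan_in.
by exists (a * b), s, e; rewrite !mulrA.
Qed.

Lemma ideal_genMr (B : algType K) (S : set B) a w :
  ideal_gen S w -> ideal_gen S (w * a).
Proof.
move: w; apply: lspan_ind.
- by rewrite mul0r; exact: lspan0.
- by move=> u v ??; rewrite mulrDl; apply: lspanD.
move=> k _ [b [s [e [Ss ->]]]]; rewrite -scalerAl; apply/lspanZ/lspan_in.
by exists b, s, (e * a); rewrite !mulrA.
Qed.

Lemma ideal_mulMl (B : algType K) (I J : set B) a w :
  (forall b, I b -> I (a * b)) -> ideal_mul I J w -> ideal_mul I J (a * w).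
Proof.
move=> Ia; move: w; apply: lspan_ind.
- by rewrite mulr0; exact: lspan0.
- by move=> u v ??; rewrite mulrDr; apply: lspanD.
move=> k _ [b [s [Ib Js ->]]]; rewrite -scalerAr; apply/lspanZ/lspan_in.
by exists (a * b), s; split; rewrite ?mulrA //; apply: Ia.
Qed.

Lemma ideal_mulMr (B : algType K) (I J : set B) a w :
  (forall b, J b -> J (b * a)) -> ideal_mul I J w -> ideal_mul I J (w * a).
Proof.
move=> Ja; move: w; apply: lspan_ind.
- by rewrite mul0r; exact: lspan0.
- by move=> u v ??; rewrite mulrDl; apply: lspanD.
move=> k _ [b [s [Ib Js ->]]]; rewrite -scalerAl; apply/lspanZ/lspan_in.
by exists b, (s * a); split; rewrite ?mulrA //; apply: Ja.
Qed.

Lemma has_basis_leq (V : lmodType K) (W : set V) m n :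
  has_basis W m -> has_basis W n -> (m <= n)%N.
Proof.
case=> b [Wb b_free _] [e [_ _ e_span]]; rewrite leqNgt; apply/negP => lt_nm.
have /choice [M Mb] : forall i, exists c : 'I_n -> K, b i = \sum_j c j *: e j.
  by move=> i; apply/e_span/Wb.
pose A : 'M[K]_(m, n) := \matrix_(i, j) M i j.
have : kermx A != 0.
  by rewrite kermx_eq0 /row_free neq_ltn (leq_ltn_trans (rank_leq_col A)).
case/rowV0Pn => u /sub_kermxP uA0 /eqP []; apply/rowP => i; rewrite mxE.
apply: (b_free (fun i => u 0 i)).
transitivity (\sum_i \sum_j (u 0 i * M i j) *: e j).
  apply: eq_bigr => k _; rewrite Mb scaler_sumr; apply: eq_bigr => j _.
  by rewrite scalerA.
rewrite exchange_big big1 //= => j _; rewrite -scaler_suml.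
move/rowP: uA0 => /(_ j); rewrite !mxE => uA0.
rewrite [X in X *: _](_ : _ = 0) ?scale0r // -[RHS]uA0.
by apply: eq_bigr => k _; rewrite mxE.
Qed.

Lemma vdimE (V : lmodType K) (W : set V) m : has_basis W m -> vdim W = m.
Proof.
move=> Wm; rewrite /vdim; case: xgetP => [n _ Wn|/(_ m) //].
by apply/eqP; rewrite eqn_leq !(@has_basis_leq _ W).
Qed.

End SpanTheory.

Fact malg_scaleAr (M : monomType) (R : comNzRingType) (k : R)
    (a b : {malg R[M]}) :
  k *: (a * b) = a * (k *: b).
Proof.
apply/malgP => m; rewrite [LHS]monalg.mcoeffZ.
rewrite (monalg.mcoeffMlw _ (fsubset_refl _) (monalg.msuppZ_le k b)).
rewrite monalg.mcoeffMl mulr_sumr.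
apply: eq_bigr => i _; rewrite mulr_sumr; apply: eq_bigr => j _.
by rewrite monalg.mcoeffZ mulrnAr mulrCA.
Qed.

Section FreeAlgebra.
Variables (K : fieldType) (n : nat).

Definition free_alg : predArgType := {malg K[{fmonom 'I_n}]}.

HB.instance Definition _ := GRing.Lalgebra.on free_alg.

Definition free_gen (i : 'I_n) : free_alg := << fmu i >>.

Fact free_alg_scaleAr (k : K) (a b : free_alg) : k *: (a * b) = a * (k *: b).
Proof. exact: malg_scaleAr. Qed.

HB.instance Definition _ :=
  GRing.Lalgebra_isAlgebra.Build K free_alg free_alg_scaleAr.

(* (A_n')^2 as a decidable two-sided ideal *)
Definition comm2 : {pred free_alg} :=
  fun a => `[< ideal_mul (comm_ideal free_alg) (comm_ideal free_alg) a >].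

Lemma comm2P a :
  reflect (ideal_mul (comm_ideal free_alg) (comm_ideal free_alg) a)
          (a \in comm2).
Proof. exact: asboolP. Qed.

Fact comm2_zmod : zmod_closed comm2.
Proof.
split=> [|a b /comm2P Ia /comm2P Ib]; apply/comm2P; first exact: lspan0.
by rewrite -scaleN1r; apply/lspanD/lspanZ.
Qed.

HB.instance Definition _ := GRing.isZmodClosed.Build free_alg comm2 comm2_zmod.

Lemma comm2Ml a b : b \in comm2 -> a * b \in comm2.
Proof.
by move/comm2P=> Ib; apply/comm2P/ideal_mulMl => // c; apply: ideal_genMl.
Qed.

Lemma comm2Mr a b : b \in comm2 -> b * a \in comm2.
Proof.
by move/comm2P=> Ib; apply/comm2P/ideal_mulMr => // c; apply: ideal_genMr.
Qed.

Lemma comm2Z k a : a \in comm2 -> k *: a \in comm2.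
Proof. by move/comm2P=> Ia; apply/comm2P/lspanZ. Qed.

Let mconst : free_alg -> K := monalg.mcoeff (mone : {fmonom 'I_n}).

Let mconst0 : mconst 0 = 0.
Proof. exact: monalg.mcoeff0. Qed.

Let mconst1 : mconst 1 = 1.
Proof. exact: (rmorph1 (monalg.mcoeff (mone : {fmonom 'I_n}))). Qed.

Let mconstD a b : mconst (a + b) = mconst a + mconst b.
Proof. exact: monalg.mcoeffD. Qed.

Let mconstZ k a : mconst (k *: a) = k * mconst a.
Proof. exact: monalg.mcoeffZ. Qed.

Let mconstM a b : mconst (a * b) = mconst a * mconst b.
Proof. exact: (rmorphM (monalg.mcoeff (mone : {fmonom 'I_n}))). Qed.

Let mconst_comm a : comm_ideal free_alg a -> mconst a = 0.
Proof.
move: a; apply: lspan_ind => [|u v|k _ [a [_ [b [[c [d ->]] ->]]]]] //.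
- by rewrite mconstD => -> ->; rewrite addr0.
rewrite mconstZ !mconstM -scaleN1r mconstD mconstZ !mconstM.
by rewrite [X in _ + _ * X]mulrC mulN1r subrr mulr0 mul0r mulr0.
Qed.

Lemma comm2_1 : 1 \notin comm2.
Proof.
apply/negP => /comm2P I1.
suff: mconst 1 = 0 by rewrite mconst1 => /eqP; rewrite oner_eq0.
move: (1 : free_alg) I1; apply: lspan_ind => [|u v|k _ [a [b [Ia Ib ->]]]] //.
- by rewrite mconstD => -> ->; rewrite addr0.
by rewrite mconstZ mconstM mconst_comm // mul0r mulr0.
Qed.

Definition metab : predArgType := {ideal_quot comm2}.

HB.instance Definition _ := GRing.Zmodule.on metab.
HB.instance Definition _ := EqQuotient.on metab.

Lemma pi_metab_eq (a b : free_alg) :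
  (\pi_metab a == \pi_metab b) = (a - b \in comm2).
Proof. by rewrite -(Quotient.idealrBE comm2). Qed.

Lemma repr_metab (a : free_alg) : repr (\pi_metab a) - a \in comm2.
Proof. by rewrite -pi_metab_eq reprK. Qed.

Lemma metabP (a : metab) : exists b : free_alg, a = \pi_metab b.
Proof. by exists (repr a); rewrite reprK. Qed.

Definition metab_mul (a b : metab) : metab :=
  locked (\pi_metab (repr a * repr b)).
Definition metab_scale (k : K) (a : metab) : metab :=
  locked (\pi_metab (k *: repr a)).

Fact metab_mulE (a b : free_alg) :
  metab_mul (\pi a) (\pi b) = \pi_metab (a * b).
Proof.
apply/eqP; rewrite /metab_mul -lock pi_metab_eq.
have -> (u v : free_alg) : u * v - a * b = (u - a) * v + a * (v - b).
  by rewrite mulrBl mulrBr addrA subrK.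
by apply: rpredD; [apply: comm2Mr | apply: comm2Ml]; apply: repr_metab.
Qed.

Fact metab_scaleE k (a : free_alg) :
  metab_scale k (\pi a) = \pi_metab (k *: a).
Proof.
apply/eqP; rewrite /metab_scale -lock pi_metab_eq -scalerBr.
by apply/comm2Z/repr_metab.
Qed.

Fact pi_metabD (a b : free_alg) : \pi_metab (a + b) = \pi a + \pi b.
Proof. exact: Quotient.pi_add. Qed.

Fact metab_mulA : associative metab_mul.
Proof.
move=> a b c; move: (metabP a) => [{}a ->];
  move: (metabP b) => [{}b ->]; move: (metabP c) => [{}c ->].
by rewrite !metab_mulE mulrA.
Qed.

Fact metab_mul1 : left_id (\pi_metab 1) metab_mul.
Proof. by move=> a; move: (metabP a) => [{}a ->]; rewrite metab_mulE mul1r. Qed.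

Fact metab_mulr1 : right_id (\pi_metab 1) metab_mul.
Proof. by move=> a; move: (metabP a) => [{}a ->]; rewrite metab_mulE mulr1. Qed.

Fact metab_mulDl : left_distributive metab_mul +%R.
Proof.
move=> a b c; move: (metabP a) => [{}a ->];
  move: (metabP b) => [{}b ->]; move: (metabP c) => [{}c ->].
by rewrite -pi_metabD !metab_mulE -pi_metabD mulrDl.
Qed.

Fact metab_mulDr : right_distributive metab_mul +%R.
Proof.
move=> a b c; move: (metabP a) => [{}a ->];
  move: (metabP b) => [{}b ->]; move: (metabP c) => [{}c ->].
by rewrite -pi_metabD !metab_mulE -pi_metabD mulrDr.
Qed.

Fact pi_metab0 : \pi_metab 0 = 0.
Proof. by apply: (@addrI _ (\pi_metab 0)); rewrite -pi_metabD !addr0. Qed.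

Fact metab1_neq0 : \pi_metab 1 != 0.
Proof. by rewrite -pi_metab0 pi_metab_eq subr0 comm2_1. Qed.

HB.instance Definition _ := GRing.Zmodule_isNzRing.Build metab
  metab_mulA metab_mul1 metab_mulr1 metab_mulDl metab_mulDr metab1_neq0.

Fact metab_scaleA k l (a : metab) :
  metab_scale k (metab_scale l a) = metab_scale (k * l) a.
Proof. by move: (metabP a) => [{}a ->]; rewrite !metab_scaleE scalerA. Qed.

Fact metab_scale1 : left_id 1 metab_scale.
Proof.
by move=> a; move: (metabP a) => [{}a ->]; rewrite metab_scaleE scale1r.
Qed.

Fact metab_scaleDr : right_distributive metab_scale +%R.
Proof.
move=> k a b; move: (metabP a) => [{}a ->];
  move: (metabP b) => [{}b ->].
by rewrite -pi_metabD !metab_scaleE -pi_metabD scalerDr.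
Qed.

Fact metab_scaleDl (a : metab) : {morph metab_scale^~ a : k l / k + l}.
Proof.
move=> k l; move: (metabP a) => [{}a ->].
by rewrite !metab_scaleE -pi_metabD scalerDl.
Qed.

HB.instance Definition _ := GRing.Zmodule_isLmodule.Build K metab
  metab_scaleA metab_scale1 metab_scaleDr metab_scaleDl.

Fact metab_scaleAl k (a b : metab) : k *: (a * b) = (k *: a) * b.
Proof.
move: (metabP a) => [{}a ->];
  move: (metabP b) => [{}b ->]; rewrite -[RHS]/(metab_mul (metab_scale _ _) _).
rewrite -[LHS]/(metab_scale _ (metab_mul _ _)).
by rewrite metab_scaleE !metab_mulE metab_scaleE scalerAl.
Qed.

HB.instance Definition _ :=
  GRing.Lmodule_isLalgebra.Build K metab metab_scaleAl.

Fact metab_scaleAr k (a b : metab) : k *: (a * b) = a * (k *: b).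
Proof.
move: (metabP a) => [{}a ->];
  move: (metabP b) => [{}b ->]; rewrite -[RHS]/(metab_mul _ (metab_scale _ _)).
rewrite -[LHS]/(metab_scale _ (metab_mul _ _)).
by rewrite metab_scaleE !metab_mulE metab_scaleE scalerAr.
Qed.

HB.instance Definition _ :=
  GRing.Lalgebra_isAlgebra.Build K metab metab_scaleAr.

Lemma pi_metabM (a b : free_alg) :
  \pi_metab (a * b) = \pi_metab a * \pi_metab b.
Proof. exact/esym/metab_mulE. Qed.

Lemma pi_metab1 : \pi_metab 1 = 1.
Proof. by []. Qed.

Lemma pi_metabZ k (a : free_alg) : \pi_metab (k *: a) = k *: \pi_metab a.
Proof. exact/esym/metab_scaleE. Qed.

Definition metab_gen (i : 'I_n) : metab := \pi_metab (free_gen i).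

End FreeAlgebra.

Section HilbertSeries.
Variable K : fieldType.

Section Components.
Variables (B : algType K) (I : finType) (x : I -> B) (wt : I -> nat * nat).

Definition hom_comp (n : nat) : set B :=
  lspan [set w | exists s : seq I, size s = n /\ w = \prod_(i <- s) x i].

Definition bihom_comp (n n1 n2 : nat) : set B :=
  lspan [set w | exists s : seq I,
    [/\ size s = n, (\sum_(i <- s) (wt i).1)%N = n1,
        (\sum_(i <- s) (wt i).2)%N = n2 & w = \prod_(i <- s) x i]].

Definition hilb (W : set B) : {fps int} :=
  Fps (fun n => (vdim (W `&` hom_comp n))%:Z).

(* Nested series: z outermost, then t1, then t2. *)
Definition hilbGL2 (W : set B) : {fps {fps {fps int}}} :=
  Fps (fun n => Fps (fun n1 => Fps (fun n2 =>
    (vdim (W `&` bihom_comp n n1 n2))%:Z))).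

End Components.

Definition derivation (B : algType K) (D : {linear B -> B}) : Prop :=
  forall a b, D (a * b) = D a * b + a * D b.

Definition constants (B : algType K) (D : {linear B -> B}) (W : set B) :
    set B :=
  W `&` [set w | D w = 0].

End HilbertSeries.

(* K[U_n, V_n], with the u's first; not written {mpoly K[n + n]} because monalg
   and mpoly both declare that notation. *)
Notation uvpoly K n := (mpoly (n + n) K).

(* A Jordan type [:: p_1; ...; p_s] numbers the generators 0, ..., d-1 cell by
   cell, d = (p_1 + 1) + ... + (p_s + 1): the generator j is the one of offset
   k = jpos p j in the cell jcell p j. *)
Definition jsizes (p : seq nat) : seq nat := [seq q.+1 | q <- p].
Definition jdim (p : seq nat) : nat := sumn (jsizes p).
Definition jcell (p : seq nat) (j : nat) : nat := reshape_index (jsizes p) j.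
Definition jpos (p : seq nat) (j : nat) : nat := reshape_offset (jsizes p) j.

Definition jbideg (p : seq nat) (j : nat) : nat * nat :=
  ((nth 0%N p (jcell p j) - jpos p j)%N, jpos p j).

Section Weitzenboeck.
Variable K : fieldType.

Definition jordan_mx (p : seq nat) : 'M[K]_(jdim p) :=
  \matrix_(i, j) ((jcell p i == jcell p j) && (jpos p j == (jpos p i).+1))%:R.

Definition acts_by (B : algType K) n (alpha : 'M[K]_n) (x : 'I_n -> B)
    (D : {linear B -> B}) : Prop :=
  forall j, D (x j) = \sum_i alpha i j *: x i.

Definition metab_weitzenboeck (p : seq nat)
    (D : {linear metab K (jdim p) -> metab K (jdim p)}) : Prop :=
  derivation D /\ acts_by (jordan_mx p) (@metab_gen K (jdim p)) D.

Definition metab' n : set (metab K n) := comm_ideal (metab K n).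

Definition u_gen n (i : 'I_n) : uvpoly K n := 'X_(lshift n i).
Definition v_gen n (i : 'I_n) : uvpoly K n := 'X_(rshift n i).

Definition uv_weitzenboeck (p : seq nat)
    (D : {linear uvpoly K (jdim p) -> uvpoly K (jdim p)}) :
    Prop :=
  [/\ derivation D, acts_by (jordan_mx p) (@u_gen (jdim p)) D
    & acts_by (jordan_mx p) (@v_gen (jdim p)) D].

Definition uv_omega n : set (uvpoly K n) := ideal_gen (range (@v_gen n)).

Definition metab_hilb p (W : set (metab K (jdim p))) :=
  hilb (@metab_gen K (jdim p)) W.
Definition metab_hilbGL2 p (W : set (metab K (jdim p))) :=
  hilbGL2 (@metab_gen K (jdim p)) (fun j => jbideg p j) W.

Definition uv_gen n (k : 'I_n + 'I_n) : uvpoly K n :=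
  match k with inl i => u_gen i | inr i => v_gen i end.
Definition uv_bideg p (k : 'I_(jdim p) + 'I_(jdim p)) : nat * nat :=
  match k with inl i => jbideg p i | inr i => jbideg p i end.

Definition uv_hilb p (W : set (uvpoly K (jdim p))) :=
  hilb (@uv_gen (jdim p)) W.
Definition uv_hilbGL2 p (W : set (uvpoly K (jdim p))) :=
  hilbGL2 (@uv_gen (jdim p)) (@uv_bideg p) W.

End Weitzenboeck.

Arguments metab' : clear implicits.
Arguments uv_omega : clear implicits.

(* Main.v *)
(* Lewin's representation x_i -> [[u_i, t_i], [0, u_i - v_i]] identifies F_d' with
   the module Z_d of the (z_1, ..., z_d) in K[U_d, V_d]^d such that
   v_1 z_1 + ... + v_d z_d = 0: the commutator [x_i, x_j] goes to v_i t_j - v_j t_i,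
   and the Koszul homotopy given by the derivatives with respect to the v_i is an
   inverse up to the nonzero factors v-degree + 1.  The last coordinate of a cycle in
   Z_d belongs to the ideal generated by v_1, ..., v_(d-1).  As delta kills u_d and v_d,
   the equivariant section
     g |-> (- v_d dg/dv_1, ..., - v_d dg/dv_(d-1), E g),
   where E is the Euler operator in the v_i, splits Z_d into the direct sum of the
   u_d^a v_d^b (Z_(d-1) + K[U_(d-1), V_(d-1)]_omega).  The pairs (a, b) contribute
   the factor 1/(1-z)^2 and the last coordinate t_d contributes the factor z. *)

From HB Require Import structures.
Require Import Defs.
From mathcomp Require Import all_boot all_order all_algebra.
From mathcomp Require Import boolp classical_sets.
From mathcomp Require Import finmap monalg.
From mathcomp Require Import mpoly.
From mathcomp Require ssrcomplements.
From mathcomp Require Import ring zify.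

Set Implicit Arguments.
Unset Strict Implicit.
Unset Printing Implicit Defensive.

Import GRing.Theory.

Local Open Scope classical_set_scope.
Local Open Scope ring_scope.

(** * Linear algebra *)

Section LinearAlgebra.
Variable K : fieldType.

(** The square of the commutator ideal is zero, so left multiplications commute on it, and so do
    right ones; this turns it into a [K[U_d, V_d]]-module, with [v_i] acting as the commutator with
    [x_i]. A cycle whose last coordinate vanishes has all its coefficients at [u_d^a v_d^b] in
    [Z_(d-1)], so the obstacle is a section of the last coordinate that respects delta. Writing an
    element of the ideal as a sum of [v_i h_i] gives a section, but an arbitrary choice of the [h_i]
    does not commute with delta. If the element is written as [E g], Euler's identity supplies
    [h_i = dg/dv_i], and the commutator of [d/dv_i] with delta is the sum of the
    [alpha i j *: d/dv_j], which is the twist by which delta acts on the coordinates of [Z_d].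
    Characteristic 0 makes [E] invertible in positive v-degree, hence on the ideal. As [vdim] has a
    junk value, dimensions are compared through [has_basis], in one multidegree at a time. *)

Definition subspace (V : lmodType K) (W : set V) : Prop :=
  W 0 /\ forall k u v, W u -> W v -> W (k *: u + v).

Lemma subspaceD (V : lmodType K) (W : set V) u v :
  subspace W -> W u -> W v -> W (u + v).
Proof. by move=> [_ WD] Wu Wv; rewrite -[u]scale1r; apply: WD. Qed.

Lemma subspaceZ (V : lmodType K) (W : set V) k u :
  subspace W -> W u -> W (k *: u).
Proof. by move=> [W0 WD] Wu; rewrite -[_ *: _]addr0; apply: WD. Qed.

Lemma subspaceB (V : lmodType K) (W : set V) u v :
  subspace W -> W u -> W v -> W (u - v).
Proof.
by move=> sW Wu Wv; rewrite -scaleN1r; apply: subspaceD => //; apply: subspaceZ.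
Qed.

Lemma subspace_sum (V : lmodType K) (W : set V) (I : Type) (r : seq I)
    (P : pred I) (F : I -> V) :
  subspace W -> (forall i, P i -> W (F i)) -> W (\sum_(i <- r | P i) F i).
Proof.
move=> sW WF; elim/big_ind: _ => //; first by case: sW.
by move=> u v; apply: subspaceD.
Qed.

Lemma lspan_subspace (V : lmodType K) (S : set V) : subspace (lspan S).
Proof. by split=> [|k u v ??]; [apply: lspan0 | apply/lspanD => //; apply: lspanZ]. Qed.

Lemma lspan_min (V : lmodType K) (S W : set V) :
  subspace W -> S `<=` W -> lspan S `<=` W.
Proof.
move=> sW SW; apply: lspan_ind; first by case: sW.
  by move=> u v; apply: subspaceD.
by move=> k s /SW; apply: subspaceZ.
Qed.

Lemma subspaceI (V : lmodType K) (W W' : set V) :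
  subspace W -> subspace W' -> subspace (W `&` W').
Proof. by move=> [W0 WD] [W'0 W'D]; split=> // k u v [??] [??]; split; auto. Qed.

Lemma subspace_ker (V V' : lmodType K) (T : {linear V -> V'}) :
  subspace [set w | T w = 0].
Proof.
by split=> [|k u v] /=; rewrite ?linear0 // linearP => -> ->; rewrite scaler0 addr0.
Qed.

(** The product of the [T - mu i] kills every [b i], hence [w], but it acts on [w] as the nonzero
    scalar with factors [l - mu i]. The [b i] may be dependent and the [mu i] may repeat. *)
Lemma eigen_other (V : lmodType K) (T : {linear V -> V}) (l : K) m
    (c : 'I_m -> K) (b : 'I_m -> V) (mu : 'I_m -> K) :
    (forall i, T (b i) = mu i *: b i) -> (forall i, mu i != l) ->
  let w := \sum_i c i *: b i in T w = l *: w -> w = 0.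
Proof.
move=> Tb ml w Tw.
pose O i (v : V) := T v - mu i *: v.
have Ofold (r : seq 'I_m) : foldr O w r = (\prod_(i <- r) (l - mu i)) *: w.
  elim: r => [|i r IH] /=; first by rewrite big_nil scale1r.
  by rewrite IH /O linearZ /= Tw big_cons !scalerA -scalerBl mulrC mulrBl.
have OS (r : seq 'I_m) : foldr O w r =
    \sum_i (c i * \prod_(j <- r) (mu i - mu j)) *: b i.
  elim: r => [|j r IH] /=.
    by apply: eq_bigr => i _; rewrite big_nil mulr1.
  rewrite IH /O linear_sum scaler_sumr -sumrB; apply: eq_bigr => i _.
  by rewrite linearZ /= Tb big_cons !scalerA -scalerBl; congr (_ *: _); ring.
move: (OS (index_enum _)); rewrite Ofold [RHS]big1 => [/eqP|i _]; last first.
  by rewrite (bigD1 i) //= subrr mul0r mulr0 scale0r.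
rewrite scaler_eq0 => /orP[|/eqP//] /prodf_eq0[i _].
by rewrite subr_eq0 eq_sym (negPf (ml i)).
Qed.

Lemma basis_fin (V : lmodType K) (W : set V) (I : finType) (b : I -> V) :
    (forall i, W (b i)) ->
    (forall c : I -> K, \sum_i c i *: b i = 0 -> forall i, c i = 0) ->
    (forall w, W w -> exists c : I -> K, w = \sum_i c i *: b i) ->
  has_basis W #|I|.
Proof.
move=> Wb bfree bspan; exists (fun j => b (enum_val j)); split=> //.
  move=> c c0 i; rewrite -[i]enum_valK.
  apply: (bfree (fun j => c (enum_rank j))); rewrite -[RHS]c0.
  by rewrite [RHS](reindex_onto enum_rank enum_val) /= => [|j _];
    rewrite ?enum_valK //; apply: eq_big => [j|j _]; rewrite ?enum_rankK ?eqxx.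
move=> w /bspan[c ->]; exists (fun j => c (enum_val j)).
rewrite [RHS](reindex_onto enum_rank enum_val) /= => [|j _]; last by rewrite enum_valK.
by apply: eq_big => [j|j _]; rewrite ?enum_rankK ?eqxx.
Qed.

Lemma has_basis0 (V : lmodType K) : has_basis [set w : V | w = 0] 0.
Proof.
exists (fun=> 0); split=> // [c _ []//|w /= ->] //.
by exists (fun=> 0); rewrite big_ord0.
Qed.

Lemma free_leq_span (V : lmodType K) m n (b : 'I_m -> V) (e : 'I_n -> V) :
    (forall c : 'I_m -> K, \sum_i c i *: b i = 0 -> forall i, c i = 0) ->
    (forall i, exists c : 'I_n -> K, b i = \sum_j c j *: e j) ->
  (m <= n)%N.
Proof.
move=> bfree bspan.
move/choice: bspan => [M Mb]; rewrite leqNgt; apply/negP => lt_nm.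
pose A : 'M[K]_(m, n) := \matrix_(i, j) M i j.
have : kermx A != 0.
  by rewrite kermx_eq0 /row_free neq_ltn (leq_ltn_trans (rank_leq_col A)).
case/rowV0Pn => u /sub_kermxP uA0 /eqP []; apply/rowP => i; rewrite mxE.
apply: (bfree (fun i => u 0 i)).
transitivity (\sum_i \sum_j (u 0 i * M i j) *: e j).
  apply: eq_bigr => k _; rewrite Mb scaler_sumr; apply: eq_bigr => j _.
  by rewrite scalerA.
rewrite exchange_big big1 //= => j _; rewrite -scaler_suml.
move/rowP: uA0 => /(_ j); rewrite !mxE => uA0.
rewrite [X in X *: _](_ : _ = 0) ?scale0r // -[RHS]uA0.
by apply: eq_bigr => k _; rewrite mxE.
Qed.

(** A free family in [W] of maximal size is a basis; its size is bounded by [n], although the [e j]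
    need not lie in [W]. *)
Lemma subspace_has_basis (V : lmodType K) (W : set V) n (e : 'I_n -> V) :
    subspace W -> (forall w, W w -> exists c : 'I_n -> K, w = \sum_j c j *: e j) ->
  exists m, has_basis W m.
Proof.
move=> sW We.
pose P m := `[< exists b : 'I_m -> V, (forall i, W (b i)) /\
   (forall c : 'I_m -> K, \sum_i c i *: b i = 0 -> forall i, c i = 0) >].
have P0 : exists m, P m by exists 0%N; apply/asboolP; exists (fun=> 0); split=> [[]|c _ []].
have Pb m : P m -> (m <= n)%N.
  by move=> /asboolP[b [Wb bf]]; apply: (free_leq_span bf) => i; apply/We/Wb.
case: (ex_maxnP P0 Pb) => m /asboolP[b [Wb bf]] mmax; exists m, b; split=> // w Ww.
apply: contrapT => nw.
suff : P m.+1 by move/mmax; rewrite ltnn.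
apply/asboolP; exists (fun i => if unlift ord0 i is Some j then b j else w); split.
  by move=> i; case: unliftP.
move=> c; rewrite big_ord_recl unlift_none.
under eq_bigr do rewrite liftK.
move=> cE; have c0 : c ord0 = 0.
  apply: contrapT => /eqP c0; apply: nw.
  exists (fun i => - (c ord0)^-1 * c (lift ord0 i)).
  move/eqP: cE; rewrite addr_eq0 => /eqP/(congr1 (fun v => (c ord0)^-1 *: v)).
  rewrite scalerA mulVf // scale1r => ->; rewrite scalerN scaler_sumr -sumrN.
  by apply: eq_bigr => i _; rewrite scalerA mulNr scaleNr.
move: cE; rewrite c0 scale0r add0r => cE i.
by case: (unliftP ord0 i) => [j ->|-> //]; apply: (bf (fun j => c (lift ord0 j))).
Qed.

(** Excludes the junk value: here [vdim] is a true dimension. *)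
Lemma has_basis_vdim (V : lmodType K) (W : set V) n (e : 'I_n -> V) :
    subspace W -> (forall w, W w -> exists c : 'I_n -> K, w = \sum_j c j *: e j) ->
  has_basis W (vdim W).
Proof. by move=> sW /(subspace_has_basis sW)[m Wm]; rewrite (vdimE Wm). Qed.

Lemma has_basis_sum (V : lmodType K) (W : set V) (J : finType)
    (U : J -> lmodType K) (X : forall j, set (U j)) (m : J -> nat)
    (T : forall j, {linear U j -> V}) :
    (forall j, has_basis (X j) (m j)) ->
    (forall j, subspace (X j)) ->
    (forall f : forall j, U j, (forall j, X j (f j)) ->
       \sum_j T j (f j) = 0 -> forall j, f j = 0) ->
    (forall w, W w <-> exists f : forall j, U j, (forall j, X j (f j)) /\
       w = \sum_j T j (f j)) ->
  has_basis W (\sum_j m j)%N.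
Proof.
move=> Xm sX Tinj WT.
have Xm' j : {b : 'I_(m j) -> U j | [/\ forall i, X j (b i),
        forall c : 'I_(m j) -> K, \sum_i c i *: b i = 0 -> forall i, c i = 0
      & forall w, X j w -> exists c : 'I_(m j) -> K, w = \sum_i c i *: b i]}.
  exact: cid (Xm j).
pose b j := sval (Xm' j).
have bP j : [/\ forall i, X j (b j i),
        forall c : 'I_(m j) -> K, \sum_i c i *: b j i = 0 -> forall i, c i = 0
      & forall w, X j w -> exists c : 'I_(m j) -> K, w = \sum_i c i *: b j i].
  exact: (svalP (Xm' j)).
pose I := {j : J & 'I_(m j)}.
pose tg j (i : 'I_(m j)) : I := existT _ j i.
have <- : #|{: I}| = (\sum_j m j)%N.
  rewrite card_tagged sumnE big_map big_enum /=; apply: eq_bigr => j _.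
  by rewrite card_ord.
have sumE (c : I -> K) : \sum_(x : I) c x *: T (tag x) (b (tag x) (tagged x)) =
   \sum_j T j (\sum_i c (tg _ i) *: b j i).
  under [RHS]eq_bigr => j _ do rewrite linear_sum.
  rewrite (@sig_big_dep _ _ _ _ (fun j => 'I_(m j)) predT (fun _ => predT)
     (fun j i => T j (c (tg _ i) *: b j i))) /=.
  by apply: eq_bigr => -[j i] _ /=; rewrite linearZ.
apply: (@basis_fin _ W {j : J & 'I_(m j)}
   (fun x => T (tag x) (b (tag x) (tagged x)))).
- move=> [j i] /=; apply/WT.
  (* The family concentrated at [j]; since [U] depends on the index, its entry at [k = j] is a
     transport of [b j i]. *)
  exists (fun k => if pselect (j = k) is left e then ecast k (U k) e (b j i) else 0).
  split=> [k|].
    case: pselect => [e|_]; last by case: (sX k).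
    by case: k / e => /=; case: (bP j).
  rewrite (bigD1 j) //= big1 ?addr0 => [|k /eqP kj].
    by case: pselect => // e; rewrite (Prop_irrelevance e erefl).
  by case: pselect => [e|_]; [case: kj | rewrite linear0].
- move=> c; rewrite sumE => c0 [j i].
  have: \sum_i c (tg _ i) *: b j i = 0.
    apply: (Tinj (fun j => \sum_i c (tg _ i) *: b j i)) => // k.
    by apply: subspace_sum => // x _; apply: subspaceZ => //; case: (bP k).
  by case: (bP j) => _ bf _ /bf /(_ i).
move=> w /WT[f [Xf ->]].
have Xf' j : exists c : 'I_(m j) -> K, f j = \sum_i c i *: b j i.
  by case: (bP j) => _ _; apply.
pose c (x : I) := sval (cid (Xf' (tag x))) (tagged x).
exists c; rewrite sumE; apply: eq_bigr => j _; congr (T j _).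
exact: (svalP (cid (Xf' j))).
Qed.

End LinearAlgebra.

(** * Power series *)

Section InverseSquare.
Variable R : comNzRingType.

Lemma coef_fpsZM (f : fps R) n :
  fpscoef ('z * f) n = if n is m.+1 then fpscoef f m else 0.
Proof.
rewrite -[LHS]/(\sum_(i < n.+1) (i == 1%N :> nat)%:R * fpscoef f (n - i)%N).
rewrite big_ord_recl mul0r add0r; case: n => [|n]; first by rewrite big_ord0.
rewrite big_ord_recl mul1r subSS subn0 big1 ?addr0 // => i _.
by rewrite mul0r.
Qed.

Lemma fps_inv_sq1BZ (f : fps R) :
  (1 - 'z) ^- 2 * f =
    Fps (fun n => \sum_(k < n.+1) fpscoef f (n - k)%N *+ k.+1).
Proof.
set g := Fps _.
suff -> : f = (1 - 'z) ^+ 2 * g.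
  by rewrite mulKr // unitrX // fps_unit1BZ.
have coefB (u v : fps R) m : fpscoef (u - v) m = fpscoef u m - fpscoef v m by [].
(* [h] is [f / (1 - z)], the series of partial sums; each of the two factors [1 - z] then
   telescopes. *)
pose h := Fps (fun n => \sum_(k < n.+1) fpscoef f (n - k)%N).
have hE : h = (1 - 'z) * g.
  rewrite mulrBl mul1r; apply: fpsP => -[|n].
    by rewrite coefB coef_fpsZM /= !big_ord_recl !big_ord0 subr0 mulr1n.
  rewrite coefB coef_fpsZM /= [\sum_(k < n.+2) _ *+ _]big_ord_recl /= subn0.
  rewrite big_ord_recl /= subn0 mulr1n -addrA; congr (_ + _).
  rewrite -sumrB; apply: eq_bigr => k _.
  by rewrite /bump /= add1n subSS [_ *+ k.+2]mulrS addrK.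
rewrite expr2 -mulrA -hE mulrBl mul1r; apply: fpsP => -[|n].
  by rewrite coefB coef_fpsZM /= big_ord_recl big_ord0 subr0 addr0.
rewrite coefB coef_fpsZM /= big_ord_recl /= subn0 -[LHS]addr0 -addrA.
congr (_ + _); apply/esym/eqP; rewrite subr_eq0; apply/eqP.
by apply: eq_bigr.
Qed.

End InverseSquare.

(** * Polynomials and the universal property *)

Section LinearExtension.
Variables (K : fieldType) (n : nat) (V : lmodType K) (h : 'X_{1..n} -> V).

Definition lext (f : mpoly n K) : V := \sum_(m <- msupp f) f@_m *: h m.

(** The support varies with [f]; over an index set common to several polynomials the sum is visibly
    linear. *)
Lemma lextwE k f : (msize f <= k)%N ->
  lext f = \sum_(m : 'X_{1..n < k}) f@_m *: h m.
Proof.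
pose I : subFinType _ := 'X_{1..n < k}.
move=> le_fk; rewrite /lext (ssrcomplements.big_mksub I) /=; first last.
- by move=> x /msize_mdeg_lt/leq_trans/(_ le_fk).
- exact: msupp_uniq.
by rewrite big_rmcond //= => j /memN_msupp_eq0 ->; rewrite scale0r.
Qed.

Fact lext_linear : linear lext.
Proof.
move=> c f g; pose k := maxn (msize (c *: f + g)) (maxn (msize f) (msize g)).
rewrite !(@lextwE k) ?leq_max ?leqnn ?orbT // scaler_sumr -big_split /=.
by apply: eq_bigr => m _; rewrite mcoeffD mcoeffZ scalerDl scalerA.
Qed.

HB.instance Definition _ := GRing.isLinear.Build K (mpoly n K) V _ lext lext_linear.

Lemma lextX m : lext 'X_[m] = h m.
Proof. by rewrite /lext msuppX big_seq1 mcoeffX eqxx scale1r. Qed.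

End LinearExtension.

Section MpolyTheory.
Variables (K : fieldType) (n : nat).

Lemma mpoly_linear_eq (V : lmodType K) (F G : {linear mpoly n K -> V}) :
  (forall m, F 'X_[m] = G 'X_[m]) -> F =1 G.
Proof.
move=> FG f; rewrite [f]mpolyE !linear_sum; apply: eq_bigr => m _.
by rewrite !linearZ /= FG.
Qed.

Lemma monomial_ind (P : 'X_{1..n} -> Prop) :
  P 0%MM -> (forall k m, P m -> P (U_(k) + m)%MM) -> forall m, P m.
Proof.
move=> P0 PS m; move: {2}(mdeg m) (erefl (mdeg m)) => d.
elim: d m => [|d IH] m dm; first by move/eqP: dm; rewrite mdeg_eq0 => /eqP ->.
have [k mk] : exists k, m k != 0%N.
  apply/existsP; rewrite -negb_forall; apply/negP => /forallP m0.
  suff m00: m = 0%MM by rewrite m00 mdeg0 in dm.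
  by apply/mnmP => k; rewrite mnm0E; apply/eqP.
have mE : m = (U_(k) + (m - U_(k)))%MM by rewrite addmC submK // lep1mP.
rewrite mE; apply/PS/IH; move: dm; rewrite {1}mE mdegD mdeg1; lia.
Qed.

Lemma mpoly_alg_ind (P : mpoly n K -> Prop) :
    P 1 -> (forall c f g, P f -> P g -> P (c *: f + g)) ->
    (forall k f, P f -> P ('X_k * f)) -> forall f, P f.
Proof.
move=> P1 PD PX.
have P0 : P 0 by have := PD (-1) 1 1 P1 P1; rewrite scaleN1r addNr.
move=> f; rewrite [f]mpolyE; elim: (msupp f) => [|m s IH]; first by rewrite big_nil.
rewrite big_cons; apply: PD => //; elim/monomial_ind: m => [|k m Pm].
  by rewrite mpolyX0.
by rewrite mpolyXD; apply: PX.
Qed.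

Lemma mcoeffXM (k m : 'X_{1..n}) (f : mpoly n K) :
  ('X_[k] * f)@_m = if (k <= m)%MM then f@_(m - k) else 0.
Proof.
case: ifP => km; first by rewrite -[in LHS](submK km) mulrC addmC mcoeffMX.
apply: memN_msupp_eq0; rewrite mulrC (perm_mem (msuppMX _ _)).
by apply/negP => /mapP[m' _ mE]; rewrite mE lem_addr in km.
Qed.

End MpolyTheory.

(** * Homomorphisms out of the free metabelian algebra *)

Section UniversalProperty.
Variables (K : fieldType) (n : nat) (S : nzRingType) (f : {rmorphism K -> S}).
Variable g : 'I_n -> S.
Hypothesis f_central : forall k x, f k * x = x * f k.

Let word (m : monalg.fmonom 'I_n) : S := \prod_(i <- monalg.fmonom_val m) g i.

Fact word_mmorphism : monalg.mmorphism word.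
Proof.
by split=> [x y|]; rewrite /word ?monalg.fmM ?big_cat // monalg.fm1 big_nil.
Qed.

HB.instance Definition _ :=
  monalg.isMultiplicative.Build {fmonom 'I_n} S word word_mmorphism.

Let F : free_alg K n -> S := monalg.mmap f word.

Let FD a b : F (a + b) = F a + F b.
Proof. exact: raddfD. Qed.

Let FZ k a : F (k *: a) = f k * F a.
Proof. exact: monalg.mmapZ. Qed.

Let FM a b : F (a * b) = F a * F b.
Proof.
have := @monalg.commr_mmap_is_multiplicative _ K S f word.
by move=> /(_ (fun g m m' => f_central _ _)) [+ _]; apply.
Qed.

Let Fgen i : F (free_gen K i) = g i.
Proof.
have -> : F (free_gen K i) = f 1 * word (fmu i) by exact: monalg.mmapU.
by rewrite rmorph1 mul1r /word fmU big_seq1.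
Qed.

Let FB a b : F (a - b) = F a - F b.
Proof. by rewrite -scaleN1r FD FZ rmorphN1 mulN1r. Qed.

(** Scalars enter [S] through the central map [f], so that [S] can be a ring of matrices over
    polynomials. The predicate [H] is there because commutators multiply to zero only on a subring,
    such as that of the upper triangular matrices. The factor [c] between the two commutators comes
    from multiplying elements [a1 [x, y] a2] and [b1 [z, t] b2] of the commutator ideal. *)
Lemma metab_hom (H : S -> Prop) :
    H 1 -> (forall k a, H a -> H (f k * a)) ->
    (forall a b, H a -> H b -> H (a + b)) ->
    (forall a b, H a -> H b -> H (a * b)) -> (forall i, H (g i)) ->
    (forall a b c d e, H a -> H b -> H c -> H d -> H e ->
       (a * b - b * a) * c * (d * e - e * d) = 0) ->
  exists G : metab K n -> S,
    [/\ forall k a b, G (k *: a + b) = f k * G a + G b,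
        forall a b, G (a * b) = G a * G b, G 1 = 1
      & forall i, G (metab_gen K i) = g i].
Proof.
move=> H1 HZ HD HM Hg HC.
have H0 : H 0 by have := HZ 0 1 H1; rewrite rmorph0 mul0r.
have HF a : H (F a).
  rewrite [F a]monalg.mmapE; elim: (enum_fset _) => [|m s IH].
    by rewrite big_nil.
  rewrite big_cons; apply: HD => //; apply: HZ; rewrite /word.
  by elim: (monalg.fmonom_val m) => [|i r IHr]; rewrite ?big_nil // big_cons; auto.
have F0 : F 0 = 0 by rewrite -(scale0r 0) FZ rmorph0 mul0r.
have Fc a x y b : F (a * (x * y - y * x) * b) = F a * (F x * F y - F y * F x) * F b.
  rewrite [F (_ * b)]FM [F (a * _)]FM FB; congr (_ * (_ - _) * _); exact: FM.
have Fcc a b : comm_ideal (free_alg K n) a -> comm_ideal (free_alg K n) b -> F a * F b = 0.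
  move: a; apply: lspan_ind; first by rewrite F0 mul0r.
    by move=> u v Fu Fv Cb; rewrite FD mulrDl Fu ?Fv ?addr0.
  move=> k _ [a1 [_ [a2 [[x [y ->]] ->]]]] Cb; rewrite FZ Fc -mulrA.
  suff -> : F a1 * (F x * F y - F y * F x) * F a2 * F b = 0 by rewrite mulr0.
  move: b Cb; apply: lspan_ind; first by rewrite F0 mulr0.
    by move=> u v Fu Fv; rewrite FD mulrDr Fu ?Fv ?addr0.
  move=> l _ [b1 [_ [b2 [[z [t ->]] ->]]]]; rewrite FZ f_central mulrA Fc.
  set p := F x * _ - _; set q := F z * _ - _.
  have pq0 : p * (F a2 * F b1) * q = 0 by apply: HC => //; apply: HM.
  have -> : F a1 * p * F a2 * (F b1 * q * F b2) * f l =
      F a1 * (p * (F a2 * F b1) * q) * (F b2 * f l) by rewrite !mulrA.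
  by rewrite pq0 mulr0 mul0r.
have Fker a : a \in @comm2 K n -> F a = 0.
  move/comm2P; move: a; apply: lspan_ind => // [u v|k _ [a [b [Ia Ib ->]]]].
    by rewrite FD => -> ->; rewrite addr0.
  by rewrite FZ FM Fcc // mulr0.
(* As [F] kills [comm2], its value does not depend on the representative, so [F] after [repr] is a
   homomorphism. *)
have Fpi a : F (repr (\pi_(metab K n) a)%qT) = F a.
  by apply/eqP; rewrite -subr_eq0 -FB Fker // repr_metab.
exists (fun a => F (repr a)); split.
- move=> k a b; have [{}a ->] := metabP a; have [{}b ->] := metabP b.
  by rewrite -pi_metabZ -pi_metabD !Fpi FD FZ.
- move=> a b; have [{}a ->] := metabP a; have [{}b ->] := metabP b.
  by rewrite -pi_metabM !Fpi FM.
- by rewrite -(pi_metab1 K n) Fpi; apply: monalg.mmap1.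
by move=> i; rewrite Fpi Fgen.
Qed.

End UniversalProperty.

Lemma malg_monomE (R : nzRingType) (M : monomType) (c : R) (m : M) :
  (<< c *g m >> = c *: << m >>)%M.
Proof. by apply/malgP => k; rewrite monalg.mcoeffZ !monalg.mcoeffU mulr_natr. Qed.


(** * Commutator ideals *)

Section CommutatorIdeal.
Variables (K : fieldType) (B : algType K).

Lemma comm_idealB (a b : B) : comm_ideal B (a * b - b * a).
Proof.
apply: lspan_in; exists 1, (a * b - b * a), 1; rewrite mul1r mulr1.
by split=> //; exists a, b.
Qed.

Lemma comm_ideal_subspace : subspace (comm_ideal B).
Proof. exact: lspan_subspace. Qed.

Lemma comm_idealMl (a c : B) : comm_ideal B c -> comm_ideal B (a * c).
Proof. exact: ideal_genMl. Qed.

Lemma comm_idealMr (a c : B) : comm_ideal B c -> comm_ideal B (c * a).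
Proof. exact: ideal_genMr. Qed.

(** In the Leibniz expansion of [D (a [c, d] b)], the middle term contains [[D c, d] + [c, D d]]. *)
Lemma comm_ideal_derivation (D : {linear B -> B}) c :
  derivation D -> comm_ideal B c -> comm_ideal B (D c).
Proof.
move=> Dder; have sC := comm_ideal_subspace.
move: c; apply: lspan_ind; first by rewrite linear0; apply: lspan0.
  by move=> u v Cu Cv; rewrite linearD; apply: subspaceD.
move=> k _ [a [_ [b [[c [d ->]] ->]]]]; rewrite linearZ; apply: subspaceZ => //.
rewrite !Dder !linearB /= !Dder; apply: subspaceD => //.
  rewrite mulrDl; apply: subspaceD => //.
    by apply/comm_idealMr/comm_idealMl/comm_idealB.
  apply/comm_idealMr/comm_idealMl.
  rewrite [X in _ - X]addrC opprD addrACA; apply: subspaceD => //; exact: comm_idealB.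
by apply/comm_idealMr/comm_idealMl/comm_idealB.
Qed.


Lemma comm_ideal_lift (A : algType K) (pi : A -> B) (c : B) :
    (forall k a b, pi (k *: a + b) = k *: pi a + pi b) ->
    (forall a b, pi (a * b) = pi a * pi b) -> (forall b, exists a, b = pi a) ->
  comm_ideal B c -> exists2 c' : A, comm_ideal A c' & c = pi c'.
Proof.
move=> piP piM pi_onto.
have pi0 : pi 0 = 0 by have := piP (-1) 0 0; rewrite scaler0 add0r scaleN1r addNr.
have piD a b : pi (a + b) = pi a + pi b by rewrite -[a]scale1r piP !scale1r.
have piZ k a : pi (k *: a) = k *: pi a by rewrite -[k *: a]addr0 piP pi0 addr0.
move: c; apply: lspan_ind.
- by exists 0; [apply: lspan0 | rewrite pi0].
- move=> u v [u' Cu ->] [v' Cv ->]; exists (u' + v'); last by rewrite piD.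
  exact: lspanD.
move=> k _ [a [_ [b [[c [d ->]] ->]]]].
have [{}a ->] := pi_onto a; have [{}b ->] := pi_onto b.
have [{}c ->] := pi_onto c; have [{}d ->] := pi_onto d.
exists (k *: (a * (c * d - d * c) * b)).
  by apply/lspanZ/lspan_in; exists a, (c * d - d * c), b; split=> //; exists c, d.
by rewrite piZ !piM -scaleN1r addrC -[in RHS]scaleN1r [in RHS]addrC piP !piM.
Qed.

Hypothesis comm_sq0 : forall c d : B, comm_ideal B c -> comm_ideal B d -> c * d = 0.

(** The difference is [[a, b] c], a product of two elements of the commutator ideal. *)
Lemma comm_ideal_mulC (a b c : B) : comm_ideal B c -> a * (b * c) = b * (a * c).
Proof.
move=> Cc; apply/eqP; rewrite -subr_eq0 !mulrA -mulrBl; apply/eqP.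
by apply: comm_sq0 => //; apply: comm_idealB.
Qed.

Lemma comm_ideal_mulCr (a b c : B) : comm_ideal B c -> c * a * b = c * b * a.
Proof.
move=> Cc; apply/eqP; rewrite -subr_eq0 -!mulrA -mulrBr; apply/eqP.
by apply: comm_sq0 => //; apply: comm_idealB.
Qed.


End CommutatorIdeal.

(** Generation of [B] as a unitary algebra, in the form of an induction principle; words are built
    from the left. *)
Definition alg_gen (K : fieldType) (B : algType K) (I : Type) (x : I -> B) : Prop :=
  forall P : B -> Prop,
    P 1 -> (forall k a b, P a -> P b -> P (k *: a + b)) ->
    (forall i a, P a -> P (x i * a)) -> forall a, P a.

Section Generators.
Variables (K : fieldType) (B : algType K) (I : Type) (x : I -> B).
Hypothesis xind : alg_gen x.

(** Commutators of generators suffice, by [[x_i a, b] = x_i [a, b] + [x_i, b] a] and the similar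
    rule in the second argument. *)
Lemma comm_ideal_min (W : set B) :
    subspace W -> (forall i a, W a -> W (x i * a)) ->
    (forall i a, W a -> W (a * x i)) ->
    (forall i j, W (x i * x j - x j * x i)) -> comm_ideal B `<=` W.
Proof.
move=> sW Wl Wr Wc.
have Wl' a c : W c -> W (a * c).
  move: a c; apply: xind => [c|k a b IHa IHb c|i a IH c] Wc'; first by rewrite mul1r.
    by rewrite mulrDl -scalerAl; case: sW => _; apply; auto.
  by rewrite -mulrA; auto.
have Wr' a c : W c -> W (c * a).
  move: a c; apply: xind => [c|k a b IHa IHb c|i a IH c] Wc'; first by rewrite mulr1.
    by rewrite mulrDr -scalerAr; case: sW => _; apply; auto.
  by rewrite mulrA; auto.
have W0 : W 0 by case: sW.
have W1 a b : W (a * b - b * a).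
  move: a b; apply: xind => [b|k a a' IHa IHa' b|i a IH b].
  - by rewrite mulr1 mul1r subrr.
  - rewrite mulrDl mulrDr -scalerAl -scalerAr opprD addrACA -scalerBr.
    by case: sW => _; apply.
  have -> : x i * a * b - b * (x i * a) = x i * (a * b - b * a) + (x i * b - b * x i) * a.
    by rewrite mulrBr mulrBl !mulrA addrA subrK.
  apply: subspaceD => //; [exact: Wl' | apply/Wr'].
  move: b; apply: xind => [|k b b' IHb IHb'|j b IHb].
  - by rewrite mulr1 mul1r subrr.
  - rewrite mulrDl mulrDr -scalerAl -scalerAr opprD addrACA -scalerBr.
    by case: sW => _; apply.
  have -> : x i * (x j * b) - x j * b * x i =
      (x i * x j - x j * x i) * b + x j * (x i * b - b * x i).
    by rewrite mulrBr mulrBl !mulrA addrA subrK.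
  by apply: subspaceD => //; [apply/Wr'/Wc | apply/Wl/IHb].
apply: lspan_min => // _ [a [_ [b [[c [d ->]] ->]]]].
by apply/Wr'/Wl'.
Qed.


End Generators.

Section Metab.
Variables (K : fieldType) (n : nat).

Lemma free_alg_gen : alg_gen (@free_gen K n).
Proof.
move=> P P1 PD PX a.
have P0 : P 0 by have := PD (-1) 1 1 P1 P1; rewrite scaleN1r addNr.
rewrite [a]monalgE; elim: (enum_fset _) => [|m s IH]; first by rewrite big_nil.
rewrite big_cons.
have -> : (<< monalg.mcoeff m a *g m >>)%M = monalg.mcoeff m a *: (<< m >> : free_alg K n)%M.
  exact: malg_monomE.
apply: PD => //; case: m => m; elim: m => [|i r IHr].
  by rewrite -fmoneE (_ : << fmone _ >> = 1)%M.
have -> : (<< FMonom (i :: r) >> = (free_gen K i : free_alg K n) * << FMonom r >>)%M.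
  rewrite /free_gen [RHS]fgmulUU mulr1; congr (mkmalgU _ _).
  by apply/val_inj; rewrite /= fmM fmU.
exact: PX.
Qed.

Lemma pi_metabP k (a b : free_alg K n) :
  (\pi_(metab K n) (k *: a + b) = k *: (\pi_(metab K n) a : metab K n) + \pi_(metab K n) b)%qT.
Proof. by rewrite (pi_metabD (k *: a) b) (pi_metabZ k a). Qed.

Lemma metab_gen_ind : alg_gen (@metab_gen K n).
Proof.
move=> P P1 PD PX a; have [{}a ->] := metabP a.
move: a; apply: free_alg_gen => [|k a b Pa Pb|i a Pa].
- by rewrite pi_metab1.
- by rewrite pi_metabP; apply: PD.
by rewrite (pi_metabM (free_gen K i) a); apply: PX.
Qed.

(** Both factors lift to the commutator ideal of the free algebra, where their product lies in
    [comm2]. *)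
Lemma metab_comm_sq0 (c d : metab K n) :
  comm_ideal (metab K n) c -> comm_ideal (metab K n) d -> c * d = 0.
Proof.
move=> Cc Cd.
have [c' Cc' ->] := comm_ideal_lift pi_metabP (@pi_metabM K n) (@metabP K n) Cc.
have [d' Cd' ->] := comm_ideal_lift pi_metabP (@pi_metabM K n) (@metabP K n) Cd.
rewrite -(pi_metabM c' d') -(pi_metab0 K n).
apply/eqP; rewrite pi_metab_eq subr0; apply/comm2P/lspan_in.
by exists c', d'.
Qed.

End Metab.

(** * Fox derivatives *)

Section FoxDerivatives.
Variables (K : fieldType) (n : nat).
Notation F := (metab K n).
Notation x := (@metab_gen K n).
Notation R := (uvpoly K n).
Notation Omega := {ffun 'I_n -> R}.

Lemma metab_hom_com (g : 'I_n -> R) : exists G : F -> R,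
  [/\ forall k a b, G (k *: a + b) = k *: G a + G b,
      forall a b, G (a * b) = G a * G b, G 1 = 1
    & forall i, G (x i) = g i].
Proof.
have [|//|//|||//||G [GP GM G1 Gx]] :=
  @metab_hom K n R (@mpolyC (n + n) K) g _ (fun=> True) => //.
- by move=> k a; rewrite mulrC.
- by move=> a b c d e *; rewrite [b * a]mulrC subrr !mul0r.
by exists G; split=> // k a b; rewrite GP mul_mpolyC.
Qed.

(** One coordinate of Lewin's representation at a time: the off-diagonal entry is the coefficient of
    [t_j], which keeps it in the polynomial ring instead of a free module. *)
Lemma metab_hom_tri (j : 'I_n) (g h : 'I_n -> R) : exists G : F -> 'M[R]_2,
  [/\ forall k a b, G (k *: a + b) = k%:MP *: G a + G b,
      forall a b, G (a * b) = G a *m G b, G 1 = 1%:M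
    & forall i, G (x i) = \matrix_(a, b) if a == 0 then if b == 0 then g i else (i == j)%:R
                                        else if b == 0 then 0 else h i].
Proof.
pose H (A : 'M[R]_2) := A 1 0 = 0.
have mulE (A B : 'M[R]_2) i k : (A *m B) i k = A i 0 * B 0 k + A i 1 * B 1 k.
  by rewrite mxE big_ord_recl big_ord1; congr (_ + A i _ * B _ k); apply: val_inj.
have [| | | | | | |G [GP GM G1 Gx]] := @metab_hom K n 'M[R]_2
  (@scalar_mx R 2 \o @mpolyC (n + n) K)
  (fun i => \matrix_(a, b) if a == 0 then if b == 0 then g i else (i == j)%:R
                                        else if b == 0 then 0 else h i) _ H.
- by move=> k A /=; apply/esym/scalar_mxC.
- by rewrite /H mxE.
- by move=> k A A0; rewrite /H /= -mulmxE mul_scalar_mx mxE A0 mulr0.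
- by move=> A B A0 B0; rewrite /H mxE A0 B0 addr0.
- by move=> A B A0 B0; rewrite /H -mulmxE mulE A0 B0 mul0r mulr0 addr0.
- by move=> i; rewrite /H mxE.
- move=> a b c d e Ha Hb Hc Hd He.
  (* Over a commutative ring, commutators of upper triangular matrices are strictly upper
     triangular; two such matrices with an upper triangular one between them multiply to zero. *)
  have sub (A B : 'M[R]_2) : H A -> H B -> forall i k,
      (A *m B - B *m A) i k = if (i == 0) && (k == 1) then (A *m B - B *m A) 0 1 else 0.
    move=> HA HB i k; have [E0 E1] : (forall z : 'I_2, z = 0 \/ z = 1) /\ (0 != 1 :> 'I_2).
      by split=> // -[[|[|//]] ?]; [left | right]; apply: val_inj.
    case: (E0 i) => ->; case: (E0 k) => -> //=; rewrite mxE mulE mxE mulE HA HB.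
    + by rewrite !mulr0 !addr0 [A 0 0 * _]mulrC subrr.
    + by rewrite !mul0r !mulr0 !addr0 subr0.
    by rewrite !mul0r !add0r [A 1 1 * _]mulrC subrr.
  have nil (P Q M : 'M[R]_2) : M 1 0 = 0 ->
      (forall i k, P i k = if (i == 0) && (k == 1) then P 0 1 else 0) ->
      (forall i k, Q i k = if (i == 0) && (k == 1) then Q 0 1 else 0) -> P *m M *m Q = 0.
    move=> M0 PE QE; apply/matrixP => i k; rewrite mulE !mulE M0 [RHS]mxE.
    by rewrite (PE i 0) (QE 1 k) andbF !mul0r !mulr0 !add0r !mul0r add0r.
  by apply: nil => // i k; apply: sub.
exists G; split=> // k a b; rewrite GP -mulmxE; congr (_ + _).
exact: mul_scalar_mx.
Qed.

(** [phi] is a derivation into a bimodule, with left action through [rhoU] and right action through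
    [rhoW]; it sends the generator [y i] to the basis vector [t_i]. *)
Definition fox_calculus (B : algType K) (y : 'I_n -> B) (rhoU rhoW : {linear B -> R})
    (phi : {linear B -> Omega}) : Prop :=
  [/\ [/\ forall a b, rhoU (a * b) = rhoU a * rhoU b, rhoU 1 = 1
        & forall i, rhoU (y i) = u_gen K i],
      [/\ forall a b, rhoW (a * b) = rhoW a * rhoW b, rhoW 1 = 1
        & forall i, rhoW (y i) = u_gen K i - v_gen K i]
    & [/\ forall a b j, phi (a * b) j = rhoU a * phi b j + phi a j * rhoW b
        & forall i j, phi (y i) j = (i == j)%:R]].

Lemma linear_of_fun (V W : lmodType K) (f : V -> W) :
  (forall k a b, f (k *: a + b) = k *: f a + f b) ->
  exists g : {linear V -> W}, g =1 f.
Proof.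
move=> fP; pose f_lin := GRing.isLinear.Build K V W _ f fP.
by exists (HB.pack_for {linear V -> W} f f_lin).
Qed.

(* The entries of the images of [F] in upper triangular matrices
   [[rhoU a, phi a j], [0, rhoW a]]: this is Lewin's representation. *)
Lemma metab_fox : exists (rhoU rhoW : {linear F -> R}) (phi : {linear F -> Omega}),
  fox_calculus x rhoU rhoW phi.
Proof.
have [U' [/linear_of_fun[U UE] UM U1 Ux]] := metab_hom_com (@u_gen K n).
have [W' [/linear_of_fun[W WE] WM W1 Wx]] :=
  metab_hom_com (fun i => u_gen K i - v_gen K i).
have /choice[G GP] j := metab_hom_tri j (@u_gen K n) (fun i => u_gen K i - v_gen K i).
(* The diagonal entries are the same for all [j], so a single pair of maps serves every coordinate
   of [phi]. *)
have GT j a : [/\ G j a 0 0 = U' a, G j a 1 1 = W' a & G j a 1 0 = 0].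
  have [Gl Gm G1 Gx] := GP j.
  move: a; apply: metab_gen_ind.
  - by rewrite G1 !mxE U1 W1.
  - move=> k a b [a0 a1 a2] [b0 b1 b2]; rewrite Gl !mxE a0 a1 a2 b0 b1 b2 mulr0 addr0.
    by rewrite -!UE -!WE !linearP -!mul_mpolyC.
  move=> i a [a0 a1 a2]; rewrite Gm Gx !mxE !big_ord_recl !big_ord0 !mxE /=.
  rewrite (_ : lift 0 0 = 1); last exact: val_inj.
  rewrite a0 a1 a2 UM WM Ux Wx !mul0r mulr0 ?addr0 ?add0r.
  by split=> //; rewrite mulr0.
have [phi phiE] : exists g : {linear F -> Omega},
    g =1 (fun a => [ffun j => G j a 0 1]).
  apply: linear_of_fun => k c d; apply/ffunP => j; rewrite !ffunE.
  by have [-> _ _ _] := GP j; rewrite !mxE mul_mpolyC.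
exists U, W, phi; split.
- by split=> [a b||i]; rewrite !UE.
- by split=> [a b||i]; rewrite !WE.
split=> [a b j|i j]; rewrite !phiE !ffunE; last first.
  by have [_ _ _ ->] := GP j; rewrite mxE.
have [_ -> _ _] := GP j; rewrite mxE !big_ord_recl big_ord0 addr0.
rewrite (_ : lift 0 0 = 1); last exact: val_inj.
by have [-> _ _] := GT j a; have [_ -> _] := GT j b; rewrite UE WE.
Qed.

End FoxDerivatives.

(** * The commutator ideal as a module of cycles *)

Section Euler.
Variables (K : fieldType) (n : nat).
Notation R := (uvpoly K n).

Definition vdeg (m : 'X_{1..n + n}) : nat := (\sum_(i < n) m (rshift n i))%N.

Lemma vdegD m m' : vdeg (m + m') = (vdeg m + vdeg m')%N.
Proof. by rewrite -big_split /=; apply: eq_bigr => i _; rewrite mnmDE. Qed.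

Lemma vdeg_v (i : 'I_n) : vdeg U_(rshift n i) = 1%N.
Proof.
rewrite /vdeg (bigD1 i) //= mnm1E eqxx big1 // => j /negPf ji.
by rewrite mnm1E eq_rshift eq_sym ji.
Qed.

(** A diagonal operator on monomials: [c e = e] gives the Euler operator in the [v_i], and
    reciprocals give the divisions by the v-degree. *)
Definition vscale (c : nat -> K) : {linear R -> R} :=
  lext (fun m => c (vdeg m) *: 'X_[m]).

Lemma vscaleX c m : vscale c 'X_[m] = c (vdeg m) *: 'X_[m].
Proof. exact: lextX. Qed.

Lemma mcoeff_vscale c (f : R) m : (vscale c f)@_m = c (vdeg m) * f@_m.
Proof.
have -> : f@_m = \sum_(k <- msupp f) f@_k * (k == m)%:R.
  by rewrite {1}[f]mpolyE raddf_sum; apply: eq_bigr => k _; rewrite /= mcoeffZ mcoeffX.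
rewrite /vscale /= /lext raddf_sum mulr_sumr /=.
apply: eq_bigr => k _; rewrite !mcoeffZ mcoeffX.
by case: eqP => [->|_]; rewrite ?mulr0 // !mulr1 mulrC.
Qed.

Lemma vscale_v c i (f : R) :
  vscale c (v_gen K i * f) = v_gen K i * vscale (fun e => c e.+1) f.
Proof.
rewrite [f]mpolyE mulr_sumr !linear_sum mulr_sumr; apply: eq_bigr => m _.
rewrite -scalerAr !linearZZ /v_gen -mpolyXD !vscaleX vdegD vdeg_v add1n mpolyXD.
by rewrite -!scalerAr.
Qed.

(** The condition is restricted to the support of [f], which permits dividing by the v-degree where
    it is positive. *)
Lemma vscale_comp c d e (f : R) : (forall i, f@_i != 0 -> c (vdeg i) * d (vdeg i) = e (vdeg i)) ->
  vscale c (vscale d f) = vscale e f.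
Proof.
move=> cde; apply/mpolyP => m; rewrite !mcoeff_vscale mulrA.
by have [->|/cde ->//] := eqVneq f@_m 0; rewrite !mulr0.
Qed.

Lemma vscale1 c (f : R) : (forall i, f@_i != 0 -> c (vdeg i) = 1) -> vscale c f = f.
Proof.
move=> c1; apply/mpolyP => m; rewrite mcoeff_vscale.
by have [->|/c1 ->] := eqVneq f@_m 0; rewrite ?mulr0 ?mul1r.
Qed.

Lemma euler_vscale (f : R) :
  \sum_i v_gen K i * f^`M(rshift n i) = vscale (fun e => e%:R) f.
Proof.
rewrite [in RHS](mpolyE f) linear_sum.
have fE i : v_gen K i * f^`M(rshift n i) =
    \sum_(m <- msupp f) v_gen K i * (f@_m *: 'X_[m])^`M(rshift n i).
  by rewrite {1}[f]mpolyE linear_sum mulr_sumr.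
under eq_bigr => i _ do rewrite fE.
rewrite exchange_big; apply: eq_bigr => m _ /=.
rewrite [RHS]linearZZ vscaleX. rewrite scalerA /vdeg natr_sum mulr_sumr scaler_suml.
apply: eq_bigr => i _; rewrite mderivZ mderivX -!scalerAr scalerA.
have [->|mi] := eqVneq (m (rshift n i)) 0%N; first by rewrite !mulr0 !scale0r.
by rewrite -mpolyXD addmC submK // lep1mP.
Qed.

End Euler.

Arguments vscale {K n} c.

(** * The polynomial module structure of the commutator ideal *)

Section Action.
Variables (K : fieldType) (n : nat) (B : algType K) (x : 'I_n -> B).
Notation R := (uvpoly K n).
Notation Omega := {ffun 'I_n -> R}.
Hypothesis sq0 : forall c d : B, comm_ideal B c -> comm_ideal B d -> c * d = 0.
Notation C := (comm_ideal B).

Let sC : subspace C. Proof. exact: comm_ideal_subspace. Qed.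

(* [lshift n i] stands for [u_i] and [rshift n i] for [v_i]. *)
Definition uv_op (k : 'I_(n + n)) (c : B) : B :=
  match split k with inl i => x i * c | inr i => x i * c - c * x i end.

Lemma uv_op_u i c : uv_op (lshift n i) c = x i * c.
Proof. by rewrite /uv_op (unsplitK (inl i)). Qed.

Lemma uv_op_v i c : uv_op (rshift n i) c = x i * c - c * x i.
Proof. by rewrite /uv_op (unsplitK (inr i)). Qed.

Fact uv_op_linear k : linear (uv_op k).
Proof.
move=> l c d; rewrite /uv_op; case: (split k) => i; rewrite mulrDr -scalerAr //.
by rewrite mulrDl -scalerAl opprD addrACA scalerBr.
Qed.

HB.instance Definition _ k := GRing.isLinear.Build K B B _ (uv_op k) (uv_op_linear k).

Lemma uv_op_in k c : C c -> C (uv_op k c).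
Proof.
move=> Cc; rewrite /uv_op; case: (split k) => i; first exact: comm_idealMl.
by apply: subspaceB; [exact: sC|exact: comm_idealMl|exact: comm_idealMr].
Qed.

Lemma uv_op_comm k l c : C c -> uv_op k (uv_op l c) = uv_op l (uv_op k c).
Proof.
move=> Cc; rewrite /uv_op; case: (split k) => i; case: (split l) => j.
- exact: comm_ideal_mulC.
- by rewrite mulrBr (comm_ideal_mulC sq0 _ _ Cc) [x i * (c * _)]mulrA.
- by rewrite mulrBr (comm_ideal_mulC sq0 (x i) _ Cc) [x j * (c * _)]mulrA.
rewrite !mulrBr !mulrBl !opprB (comm_ideal_mulC sq0 (x i) _ Cc).
rewrite (comm_ideal_mulCr sq0 (x j) _ Cc) !mulrA !addrA.
by rewrite [LHS](ACl (1*4*3*2)%AC).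
Qed.

(** The [uv_op k] are only known to commute on [C], so the product is taken in a fixed order of the
    variables. *)
Definition mon_act (m : 'X_{1..n + n}) (c : B) : B :=
  foldr (fun k => iter (m k) (uv_op k)) c (enum 'I_(n + n)).

Lemma iter_op_in k e c : C c -> C (iter e (uv_op k) c).
Proof. by move=> Cc; elim: e => //= e; apply: uv_op_in. Qed.

Lemma iter_op_comm k l e c : C c ->
  iter e (uv_op l) (uv_op k c) = uv_op k (iter e (uv_op l) c).
Proof.
move=> Cc; elim: e => //= e ->; apply: uv_op_comm; exact: iter_op_in.
Qed.

Lemma mon_act0 c : mon_act 0 c = c.
Proof. by rewrite /mon_act; elim: (enum _) => //= k s ->; rewrite mnm0E. Qed.

Lemma mon_actS k m c : C c -> mon_act (U_(k) + m) c = uv_op k (mon_act m c).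
Proof.
move=> Cc; rewrite /mon_act.
have foldC s : C (foldr (fun k => iter (m k) (uv_op k)) c s).
  by elim: s => //= l s; apply: iter_op_in.
(* For an arbitrary list the extra factor appears once per occurrence of [k]; the enumeration
   contains [k] exactly once. *)
suff E (s : seq 'I_(n + n)) : foldr (fun l => iter ((U_(k) + m)%MM l) (uv_op l)) c s =
    iter (count_mem k s) (uv_op k) (foldr (fun l => iter (m l) (uv_op l)) c s).
  by rewrite E (count_uniq_mem _ (enum_uniq _)) mem_enum.
elim: s => //= l s ->; rewrite mnmDE mnm1E [k == l]eq_sym iterD.
have IC e d : C d -> iter (m l) (uv_op l) (iter e (uv_op k) d) =
                     iter e (uv_op k) (iter (m l) (uv_op l) d).
  move=> Cd; elim: e => //= e IH; rewrite -IH iter_op_comm //; exact: iter_op_in.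
by rewrite IC //; case: (eqVneq l k) => [->|_].
Qed.

Definition act (c : B) : {linear R -> B} := lext (fun m => mon_act m c).

Lemma actX c m : act c 'X_[m] = mon_act m c.
Proof. exact: lextX. Qed.

Lemma actP c k f g : act c (k *: f + g) = k *: act c f + act c g.
Proof. exact: linearP. Qed.

Lemma act1 c : act c 1 = c.
Proof. by rewrite -mpolyX0 actX mon_act0. Qed.

Lemma act_var k c f : C c -> act c ('X_k * f) = uv_op k (act c f).
Proof.
move=> Cc; rewrite {1}[f]mpolyE mulr_sumr linear_sum.
rewrite -[act c f]/(\sum_(m <- msupp f) f@_m *: mon_act m c) linear_sum.
apply: eq_bigr => m _.
by rewrite -scalerAr !linearZZ -mpolyXD actX mon_actS.
Qed.

Lemma act_in c f : C c -> C (act c f).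
Proof.
move=> Cc; move: f; apply: mpoly_alg_ind => [|k f g Cf Cg|k f Cf]; first by rewrite act1.
  by rewrite actP; case: sC => _; apply.
by rewrite act_var //; apply: uv_op_in.
Qed.

Lemma actB c d f : C c -> C d -> act (c - d) f = act c f - act d f.
Proof.
move=> Cc Cd; have Ccd : C (c - d) by apply: subspaceB.
move: f; apply: mpoly_alg_ind => [|k f g Ef Eg|k f Ef]; first by rewrite !act1.
  by rewrite !actP Ef Eg scalerBr opprD addrACA.
by rewrite !act_var // Ef linearB.
Qed.

Lemma actN c f : C c -> act (- c) f = - act c f.
Proof.
move=> Cc; have C0 : C 0 by case: sC.
by rewrite -sub0r actB // -{1}(subrr 0) actB // subrr sub0r.
Qed.

Lemma act_op c k f : C c -> act (uv_op k c) f = act c ('X_k * f).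
Proof.
move=> Cc; rewrite act_var //; have Co := uv_op_in k Cc.
move: f; apply: mpoly_alg_ind => [|l f g Ef Eg|l f Ef]; first by rewrite !act1.
  by rewrite !actP Ef Eg linearD linearZZ.
by rewrite !act_var // Ef uv_op_comm //; apply: act_in.
Qed.

Definition com i j : B := x i * x j - x j * x i.

Lemma com_in i j : C (com i j). Proof. exact: comm_idealB. Qed.

Hypothesis xgen : alg_gen x.

(** The commutators of generators generate [C] as a module over the polynomials: right
    multiplication by [x i] is the action of [u_i - v_i]. *)
Lemma comm_ideal_span : C `<=` lspan [set c | exists i j m, c = act (com i j) 'X_[m]].
Proof.
set W := lspan _; have sW : subspace W by apply: lspan_subspace.
have Wop k c : W c -> W (uv_op k c).
  move: c; apply: lspan_ind; first by rewrite linear0; case: sW.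
    by move=> c d Wc Wd; rewrite linearD; apply: subspaceD.
  move=> l _ [i [j [m ->]]]; rewrite linearZ; apply: subspaceZ => //; apply: lspan_in.
  by exists i, j, (U_(k) + m)%MM; rewrite mpolyXD act_var //; apply: com_in.
apply: (comm_ideal_min xgen) => // [i c Wc|i c Wc|i j].
- by rewrite -uv_op_u; apply: Wop.
- rewrite (_ : c * x i = uv_op (lshift n i) c - uv_op (rshift n i) c).
    by apply: subspaceB => //; apply: Wop.
  by rewrite uv_op_u uv_op_v opprB addrCA subrr addr0.
by apply: lspan_in; exists i, j, 0%MM; rewrite mpolyX0 act1.
Qed.

(** The Koszul homotopy on [f t_j], with the 2-chain [v_i t_j - v_j t_i] replaced by the commutator
    that represents it. *)
Definition kos j (f : R) : B := \sum_i act (com i j) f^`M(rshift n i).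

Fact kos_linear j : linear (kos j).
Proof.
move=> k f g; rewrite /kos scaler_sumr -big_split; apply: eq_bigr => i _ /=.
by rewrite mderivD mderivZ actP.
Qed.

HB.instance Definition _ j := GRing.isLinear.Build K R B _ (kos j) (kos_linear j).

Definition fox_inv (z : Omega) : B := \sum_j kos j (z j).

Fact fox_inv_linear : linear fox_inv.
Proof.
move=> k f g; rewrite /fox_inv scaler_sumr -big_split; apply: eq_bigr => j _ /=.
by rewrite !ffunE linearP.
Qed.

HB.instance Definition _ := GRing.isLinear.Build K Omega B _ fox_inv fox_inv_linear.

Lemma fox_inv_in z : C (fox_inv z).
Proof.
apply: subspace_sum => // j _; apply: subspace_sum => // i _; apply: act_in.
exact: com_in.
Qed.

Lemma mderiv_v (i a : 'I_n) : (v_gen K a)^`M(rshift n i) = (i == a)%:R.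
Proof.
rewrite mderivX mnm1E eq_rshift eq_sym; case: eqVneq => [->|_]; last by rewrite scale0r.
by rewrite scale1r -[X in (X - _)%MM]add0m addmK mpolyX0.
Qed.

Lemma kos_v a b f : kos b (v_gen K a * f) =
  act (com a b) f + \sum_i act (uv_op (rshift n a) (com i b)) f^`M(rshift n i).
Proof.
rewrite /kos (bigD1 a) //= [in RHS](bigD1 a) //= addrA; congr (_ + _).
  rewrite mderivM mderiv_v eqxx mul1r linearD; congr (_ + _).
  by rewrite act_op //; apply: com_in.
apply: eq_bigr => i /negPf ia; rewrite mderivM mderiv_v ia mul0r add0r.
by rewrite act_op //; apply: com_in.
Qed.

(** The Jacobi identity, since [v_a] acts as the commutator with [x a]. *)
Lemma jacobi a b i : uv_op (rshift n a) (com i b) - uv_op (rshift n b) (com i a) =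
  uv_op (rshift n i) (com a b).
Proof.
rewrite !uv_op_v /com !mulrBr !mulrBl !mulrA.
move: (x a * x i * x b) (x a * x b * x i) (x i * x b * x a) => p q r.
move: (x b * x i * x a) (x b * x a * x i) (x i * x a * x b) => s t w.
rewrite !opprB !addrA [LHS](ACl ((1*6)*(3*8)*5*4*7*2)%AC) /=.
by rewrite !subrr !add0r.
Qed.

End Action.

(** * The isomorphism of the commutator ideal with the cycles *)

Section FoxIsomorphism.
Variables (K : fieldType) (n : nat) (B : algType K) (x : 'I_n -> B).
Notation R := (uvpoly K n).
Notation Omega := {ffun 'I_n -> R}.
Variables (rhoU rhoW : {linear B -> R}) (phi : {linear B -> Omega}).
Hypothesis charK : [pchar K] =i pred0.
Hypothesis sq0 : forall c d : B, comm_ideal B c -> comm_ideal B d -> c * d = 0.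
Hypothesis xgen : alg_gen x.
Hypothesis fox : fox_calculus x rhoU rhoW phi.
Notation C := (comm_ideal B).

Let sC : subspace C. Proof. exact: comm_ideal_subspace. Qed.

Lemma natS_neq0 e : e.+1%:R != 0 :> K.
Proof. by rewrite ((pcharf0P K).1 charK). Qed.

Lemma rho_comm0 c : C c -> rhoU c = 0 /\ rhoW c = 0.
Proof.
have [[UM _ _] [WM _ _] _] := fox.
move: c; apply: lspan_ind => [|c d [Uc Wc] [Ud Wd]|k _ [a [_ [b [[c [d ->]] ->]]]]].
- by rewrite !linear0.
- by rewrite !linearD Uc Wc Ud Wd addr0.
rewrite !linearZZ !UM !WM !linearB !UM !WM [rhoU d * _]mulrC [rhoW d * _]mulrC.
by rewrite !subrr !mulr0 !mul0r !scaler0.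
Qed.

(** On [C] both [rhoU] and [rhoW] vanish, so the twisted Leibniz rule turns left multiplication by
    [x i] into [u_i] and right multiplication into [u_i - v_i]. *)
Lemma phi_op k c j : C c -> phi (uv_op x k c) j = 'X_k * phi c j.
Proof.
have [[_ _ Ux] [_ _ Wx] [phiM _]] := fox.
move=> /rho_comm0[Uc Wc]; rewrite -[k]splitK; case: (split k) => i /=.
  by rewrite uv_op_u phiM Wc mulr0 addr0 Ux.
rewrite uv_op_v linearB !ffunE !phiM Uc Wc Ux Wx mulr0 mul0r addr0 add0r.
by rewrite [phi c j * _]mulrC mulrBl opprB addrCA subrr addr0.
Qed.

Lemma phi_act c f j : C c -> phi (act x c f) j = f * phi c j.
Proof.
move=> Cc; move: f; apply: mpoly_alg_ind => [|k f g Ef Eg|k f Ef].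
- by rewrite act1 mul1r.
- by rewrite actP linearD linearZZ !ffunE Ef Eg mulrDl scalerAl.
by rewrite act_var // phi_op ?Ef ?mulrA //; apply: act_in.
Qed.

Lemma phi_com a b j :
  phi (com x a b) j = v_gen K a * (b == j)%:R - v_gen K b * (a == j)%:R.
Proof.
have [[_ _ Ux] [_ _ Wx] [phiM phix]] := fox.
by rewrite linearB !ffunE !phiM !phix !Ux !Wx; ring.
Qed.

Lemma com_sym a b : com x b a = - com x a b.
Proof. by rewrite opprB. Qed.

(* By the Jacobi identity; on monomials of v-degree [e] this is multiplication by
   [e + 2], whence the injectivity of [phi] on the commutator ideal. *)
Lemma fox_invK a b f : fox_inv x (phi (act x (com x a b) f)) =
  act x (com x a b) (vscale (fun e => e%:R) f + f *+ 2).
Proof.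
have Ci i j : C (com x i j) by apply: com_in.
have -> : fox_inv x (phi (act x (com x a b) f)) =
    kos x b (v_gen K a * f) - kos x a (v_gen K b * f).
  have kosd i g : \sum_j kos x j (g *+ (i == j)) = kos x i g.
    rewrite (bigD1 i) //= eqxx mulr1n big1 ?addr0 // => j /negPf ji.
    by rewrite eq_sym ji mulr0n linear0.
  rewrite -(kosd b) -(kosd a) -sumrB; apply: eq_bigr => j _.
  rewrite phi_act // phi_com -linearB; congr (kos x j _).
  by rewrite !mulr_natr mulrBr !mulrnAr ![f * _]mulrC.
(* The two leading terms of [kos_v] give [2 f], as [com b a] is minus [com a b]; the two sums merge
   by [jacobi] into the Euler sum of [f]. *)
rewrite !kos_v // opprD addrACA -[X in _ + X]sumrB addrC.
rewrite (com_sym a b) actN // opprK linearD mulr2n linearD; congr (_ + _).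
rewrite -euler_vscale linear_sum; apply: eq_bigr => i _.
by rewrite -actB ?jacobi ?act_op //; apply: uv_op_in.
Qed.

(** The spanning elements of [C] may be dependent but are eigenvectors of [fox_inv] after [phi],
    with eigenvalues at least 2, while an element killed by [phi] would have eigenvalue 0. *)
Lemma phi_inj c : C c -> phi c = 0 -> c = 0.
Proof.
move=> /(comm_ideal_span sq0 xgen)[m [l [b [bC ->]]]] w0.
have bE i : exists e : nat, fox_inv x (phi (b i)) = e.+2%:R *: b i.
  have [a1 [a2 [d ->]]] := bC i; exists (vdeg d); rewrite fox_invK vscaleX.
  by rewrite -scaler_nat -scalerDl -natrD addn2 linearZZ.
have /choice[e {}bE] := bE.
pose T : {linear B -> B} := fox_inv x \o phi.
apply: (@eigen_other K B T 0 m l b (fun i => (e i).+2%:R)).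
- exact: bE.
- by move=> i; apply: natS_neq0.
by rewrite /T /= w0 linear0 scale0r.
Qed.

Definition cycles : set Omega := [set z | \sum_j v_gen K j * z j = 0].

Lemma phi_cycle c : C c -> cycles (phi c).
Proof.
have Ci i j : C (com x i j) by apply: com_in.
move/(comm_ideal_span sq0 xgen); move: c; apply: lspan_ind => [|c d|k _ [a [b [m ->]]]].
- by rewrite /cycles /= linear0 big1 // => j _; rewrite ffunE mulr0.
- rewrite /cycles /= linearD => Zc Zd; under eq_bigr => j _ do rewrite ffunE mulrDr.
  by rewrite big_split /= Zc Zd addr0.
rewrite /cycles /= linearZZ (eq_bigr (fun j => k *: ('X_[m] * (v_gen K a * (v_gen K j * (b == j)%:R)
    - v_gen K b * (v_gen K j * (a == j)%:R))))) => [|j _].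
  rewrite -scaler_sumr -mulr_sumr sumrB -!mulr_sumr.
  have E (i : 'I_n) : \sum_j v_gen K j * (i == j)%:R = v_gen K i.
    rewrite (bigD1 i) //= eqxx mulr1 big1 ?addr0 // => j /negPf ji.
    by rewrite eq_sym ji mulr0.
  by rewrite !E [v_gen K b * _]mulrC subrr mulr0 scaler0.
rewrite ffunE phi_act // phi_com -scalerAr; congr (_ *: _).
by ring.
Qed.

(** The coordinate [j] of [phi (fox_inv x z')] is [E z'_j] minus the sum of the [v_i dz'_i/dv_j].
    Differentiating the cycle relation of [z'] by [v_j] shows that this sum is [- z'_j], so the
    result is [(E + 1) z'_j]; hence the division by v-degree plus one. *)
Lemma phi_onto z : cycles z -> exists2 c, C c & phi c = z.
Proof.
move=> Zz; pose z' : Omega := [ffun j => vscale (fun e => e.+1%:R^-1) (z j)].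
have Zz' : cycles z'.
  (* Multiplication by [v_j] raises the v-degree by one, so dividing [z j] by [e + 1] amounts to
     dividing the whole relation by its v-degree. *)
  have E : vscale (fun e => e%:R^-1) (\sum_j v_gen K j * z j) = \sum_j v_gen K j * z' j.
    by rewrite linear_sum; apply: eq_bigr => j _; rewrite ffunE vscale_v.
  by rewrite /cycles /= -E Zz linear0.
exists (fox_inv x z'); first exact: fox_inv_in.
apply/ffunP => j; rewrite linear_sum sum_ffunE.
have -> : \sum_i phi (kos x i (z' i)) j =
    \sum_i (z' j)^`M(rshift n i) * v_gen K i
    - \sum_i (z' i)^`M(rshift n j) * v_gen K i.
  rewrite /kos; under eq_bigr => i _ do rewrite linear_sum sum_ffunE.
  have phiE i k : phi (act x (com x k i) (z' i)^`M(rshift n k)) j =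
     (z' i)^`M(rshift n k) * v_gen K k * (i == j)%:R -
     (z' i)^`M(rshift n k) * v_gen K i * (k == j)%:R.
    by rewrite phi_act ?phi_com; [ring | apply: com_in].
  under eq_bigr => i _ do under eq_bigr => k _ do rewrite phiE.
  under eq_bigr => i _ do rewrite sumrB.
  rewrite sumrB; congr (_ - _).
    rewrite (bigD1 j) //= [X in _ + X]big1 ?addr0 => [|i /negPf ij].
      by apply: eq_bigr => i _; rewrite eqxx mulr1.
    by rewrite big1 // => k _; rewrite ij mulr0.
  apply: eq_bigr => i _; rewrite (bigD1 j) //= eqxx mulr1 big1 ?addr0 // => k /negPf kj.
  by rewrite kj mulr0.
have : \sum_i (v_gen K i * z' i)^`M(rshift n j) = 0.
  by rewrite -linear_sum Zz' linear0.
under eq_bigr => i _ do rewrite mderivM mderiv_v.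
rewrite big_split /= (bigD1 j) //= eqxx mul1r [X in _ + X + _]big1 ?addr0 => [|i /negPf ij]; last first.
  by rewrite eq_sym ij mul0r.
move=> /eqP; rewrite addr_eq0 => /eqP zE.
under [X in _ - X]eq_bigr => i _ do rewrite mulrC.
rewrite -[- \sum_i _]zE.
under eq_bigr => i _ do rewrite mulrC.
rewrite euler_vscale ffunE (@vscale_comp _ _ _ _ (fun e => e%:R / e.+1%:R)) //.
apply/mpolyP => m; rewrite mcoeffD !mcoeff_vscale -mulrDl.
by rewrite -[X in _ + X]mul1r -mulrDl addrC nat1r divff ?mul1r ?natS_neq0.
Qed.


End FoxIsomorphism.
(** * Gradings *)

Section BasisTransfer.
Variable K : fieldType.

Lemma has_basis_image (V V' : lmodType K) (T : {linear V -> V'}) (W : set V) (W' : set V') m :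
    subspace W -> (forall w, W w -> T w = 0 -> w = 0) ->
    (forall w', W' w' <-> exists2 w, W w & T w = w') -> has_basis W m -> has_basis W' m.
Proof.
move=> sW Tinj TW [b [Wb bf bs]]; exists (fun i => T (b i)); split.
- by move=> i; apply/TW; exists (b i).
- move=> c cT; apply: bf; apply: Tinj.
    by apply: subspace_sum => // i _; apply: subspaceZ.
  by rewrite linear_sum -[RHS]cT; apply: eq_bigr => i _; rewrite linearZZ.
move=> w' /TW[w /bs[c ->] <-]; exists c; rewrite linear_sum.
by apply: eq_bigr => i _; rewrite linearZZ.
Qed.

Lemma has_basis_prod (V V' : lmodType K) (W : set V) (W' : set V') m m' :
    subspace W -> subspace W' -> has_basis W m -> has_basis W' m' ->
  has_basis ([set p | W p.1 /\ W' p.2] : set (V * V')%type) (m + m').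
Proof.
move=> [W0 _] [W'0 _] [b [Wb bf bs]] [b' [Wb' bf' bs']].
pose e (i : 'I_m + 'I_m') : (V * V')%type :=
  match i with inl i => (b i, 0) | inr j => (0, b' j) end.
have sumE c : \sum_i c i *: e i =
    (\sum_i c (inl i) *: b i, \sum_j c (inr j) *: b' j).
  rewrite big_sumType /=.
  have E1 (d : 'I_m -> K) : \sum_i d i *: (b i, 0 : V') = (\sum_i d i *: b i, 0).
    elim/big_rec2: _ => // i p q _ ->.
    by congr pair; rewrite /= ?scaler0 ?addr0.
  have E2 (d : 'I_m' -> K) : \sum_i d i *: (0 : V, b' i) = (0, \sum_i d i *: b' i).
    elim/big_rec2: _ => // i p q _ ->.
    by congr pair; rewrite /= ?scaler0 ?addr0.
  by rewrite E1 E2; congr pair; rewrite /= ?addr0 ?add0r.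
have <- : #|{: 'I_m + 'I_m'}| = (m + m')%N by rewrite card_sum !card_ord.
apply: (@basis_fin _ _ _ _ e).
- by case=> i /=; split.
- by move=> c; rewrite sumE => -[/bf c1 /bf' c2] [i|j].
move=> [w w'] /= [/bs[c ->] /bs'[c' ->]].
by exists (fun i => match i with inl i => c i | inr j => c' j end); rewrite sumE.
Qed.

End BasisTransfer.

Section GradedComponents.
Variables (K : fieldType) (T : nmodType).

Definition graded_comp (B : algType K) (I : Type) (x : I -> B) (wt : I -> T) (k : T) : set B :=
  lspan [set w | exists s : seq I, \sum_(i <- s) wt i = k /\ w = \prod_(i <- s) x i].

Section Closure.
Variables (B : algType K) (I : Type) (x : I -> B) (wt : I -> T).

Lemma graded_compMl i k a :
  graded_comp x wt k a -> graded_comp x wt (wt i + k) (x i * a).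
Proof.
move: a; apply: lspan_ind => [|a b Ga Gb|l _ [s [<- ->]]].
- by rewrite mulr0; apply: lspan0.
- by rewrite mulrDr; apply: lspanD.
rewrite -scalerAr; apply/lspanZ/lspan_in; exists (i :: s).
by rewrite !big_cons.
Qed.

Lemma graded_compMr i k a :
  graded_comp x wt k a -> graded_comp x wt (k + wt i) (a * x i).
Proof.
move: a; apply: lspan_ind => [|a b Ga Gb|l _ [s [<- ->]]].
- by rewrite mul0r; apply: lspan0.
- by rewrite mulrDl; apply: lspanD.
rewrite -scalerAl; apply/lspanZ/lspan_in; exists (rcons s i).
by rewrite !big_rcons /= addrC; split=> //; rewrite -cats1 big_cat big_seq1.
Qed.

End Closure.

Variables (n : nat) (wt : 'I_n -> T).
Notation R := (uvpoly K n).
Notation Omega := {ffun 'I_n -> R}.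

Definition uv_wt (k : 'I_(n + n)) : T :=
  match split k with inl i => wt i | inr i => wt i end.

Definition mon_wt (m : 'X_{1..n + n}) : T := \sum_k uv_wt k *+ m k.

Lemma mon_wt0 : mon_wt 0 = 0.
Proof. by apply: big1 => k _; rewrite mnm0E mulr0n. Qed.

Lemma mon_wtD m m' : mon_wt (m + m') = mon_wt m + mon_wt m'.
Proof. by rewrite -big_split; apply: eq_bigr => k _; rewrite mnmDE mulrnDr. Qed.

Lemma mon_wtU k : mon_wt U_(k) = uv_wt k.
Proof.
rewrite /mon_wt (bigD1 k) //= mnm1E eqxx big1 ?addr0 // => j /negPf jk.
by rewrite mnm1E eq_sym jk.
Qed.

Lemma uv_wt_u i : uv_wt (lshift n i) = wt i.
Proof. by rewrite /uv_wt (unsplitK (inl i)). Qed.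

Lemma uv_wt_v i : uv_wt (rshift n i) = wt i.
Proof. by rewrite /uv_wt (unsplitK (inr i)). Qed.

Definition uv_hom (k : T) : set R := [set f | forall m, f@_m != 0 -> mon_wt m = k].

Lemma uv_hom_subspace k : subspace (uv_hom k).
Proof.
split=> [m|c f g Hf Hg m]; first by rewrite mcoeff0 eqxx.
rewrite mcoeffD mcoeffZ; have [f0|/Hf //] := eqVneq f@_m 0.
by rewrite f0 mulr0 add0r; apply: Hg.
Qed.

Lemma uv_homX m : uv_hom (mon_wt m) 'X_[m].
Proof. by move=> m'; rewrite mcoeffX; case: (eqVneq m m') => [->|]; rewrite ?eqxx. Qed.

Lemma uv_homM k l f g : uv_hom k f -> uv_hom l g -> uv_hom (k + l) (f * g).
Proof.
move=> Hf Hg; rewrite mpolyME; apply: subspace_sum; first exact: uv_hom_subspace.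
move=> [a b] _ /=; have [fa|/Hf <-] := eqVneq f@_a 0.
  by rewrite fa mul0r scale0r; case: (uv_hom_subspace (k + l)).
have [gb|/Hg <-] := eqVneq g@_b 0.
  by rewrite gb mulr0 scale0r; case: (uv_hom_subspace (mon_wt a + l)).
by apply: (subspaceZ _ (uv_hom_subspace _)); rewrite -mon_wtD; apply: uv_homX.
Qed.

Definition uv_gen_wt (k : 'I_n + 'I_n) : T := match k with inl i => wt i | inr i => wt i end.

(** Passes from the spans of words that define the Hilbert series to a condition on supports, which
    can be checked coefficient by coefficient. *)
Lemma uv_hom_graded k : graded_comp (@uv_gen K n) uv_gen_wt k = uv_hom k.
Proof.
apply/seteqP; split.
  apply: lspan_min; first exact: uv_hom_subspace.
  move=> _ [s [<- ->]]; elim: s => [|i s IH].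
    by rewrite !big_nil -mon_wt0 -mpolyX0; apply: uv_homX.
  rewrite !big_cons; apply: uv_homM => //; case: i => i /=.
    by rewrite -uv_wt_u -mon_wtU; apply: uv_homX.
  by rewrite -uv_wt_v -mon_wtU; apply: uv_homX.
move=> f Hf; rewrite [f]mpolyE; apply: subspace_sum; first exact: lspan_subspace.
move=> m _; have [->|/Hf <-] := eqVneq f@_m 0; first by rewrite scale0r; apply: lspan0.
apply: lspanZ; elim/monomial_ind: m => [|i m IH].
  by rewrite mon_wt0 mpolyX0; apply: lspan_in; exists [::]; rewrite !big_nil.
rewrite mpolyXD mon_wtD mon_wtU.
have -> : uv_wt i = uv_gen_wt (split i) by rewrite /uv_wt; case: (split i).
have -> : 'X_i = uv_gen K (split i) by rewrite -{1}[i]splitK; case: (split i).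
exact: graded_compMl.
Qed.

(** The basis vector [t_j] carries the weight of [x_j], as it is the image of [x_j] under [phi]. *)
Definition fox_hom (k : T) : set Omega :=
  [set z | forall j m, (z j)@_m != 0 -> mon_wt m + wt j = k].

Lemma fox_hom_subspace k : subspace (fox_hom k).
Proof.
split=> [j m|c f g Hf Hg j m]; first by rewrite ffunE mcoeff0 eqxx.
rewrite !ffunE mcoeffD mcoeffZ; have [f0|/Hf //] := eqVneq (f j)@_m 0.
by rewrite f0 mulr0 add0r; apply: Hg.
Qed.

Variables (B : algType K) (x : 'I_n -> B).
Variables (rhoU rhoW : {linear B -> R}) (phi : {linear B -> Omega}).
Hypothesis sq0 : forall c d : B, comm_ideal B c -> comm_ideal B d -> c * d = 0.
Hypothesis xgen : alg_gen x.
Hypothesis fox : fox_calculus x rhoU rhoW phi.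
Notation C := (comm_ideal B).

Lemma phi1 : phi 1 = 0.
Proof.
have [[_ U1 _] [_ W1 _] [phiM _]] := fox; apply/ffunP => j.
have := phiM 1 1 j; rewrite mulr1 U1 W1 mul1r mulr1 -{1}[phi 1 j]addr0.
by move/addrI <-; rewrite ffunE.
Qed.

Lemma rhoW_hom k a : graded_comp x wt k a -> uv_hom k (rhoW a).
Proof.
have [_ [WM W1 Wx] _] := fox; have sH := uv_hom_subspace k.
move: a; apply: lspan_ind; first by rewrite linear0; case: sH.
  by move=> a b Ha Hb; rewrite linearD; apply: (subspaceD sH).
move=> l _ [s [<- ->]]; rewrite linearZZ; apply: (subspaceZ _ (uv_hom_subspace _)).
elim: s => [|i s IH].
  by rewrite !big_nil W1 -mon_wt0 -mpolyX0; apply: uv_homX.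
rewrite !big_cons WM; apply: uv_homM => //; rewrite Wx; apply: (subspaceB (uv_hom_subspace _)).
- by rewrite -uv_wt_u -mon_wtU; apply: uv_homX.
by rewrite -uv_wt_v -mon_wtU; apply: uv_homX.
Qed.

Lemma phi_hom k a : graded_comp x wt k a -> fox_hom k (phi a).
Proof.
have [[_ _ Ux] [_ _ Wx] [phiM phix]] := fox; have sH := fox_hom_subspace k.
move: a; apply: lspan_ind; first by rewrite linear0; case: sH.
  by move=> a b Ha Hb; rewrite linearD; apply: (subspaceD sH).
move=> l _ [s [<- ->]]; rewrite linearZZ; apply: (subspaceZ _ (fox_hom_subspace _)).
elim: s => [|i s IH].
  by rewrite !big_nil phi1; case: (fox_hom_subspace 0).
rewrite !big_cons => j m; rewrite phiM Ux phix mcoeffD.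
have [E|Hm _] := eqVneq ((u_gen K i * phi (\prod_(l <- s) x l) j)@_m) 0.
  rewrite E add0r; case: (eqVneq i j) => [->|_]; last by rewrite mul0r mcoeff0 eqxx.
  rewrite mul1r => Hm; have -> : mon_wt m = \sum_(l <- s) wt l.
    by apply: (rhoW_hom _ Hm); apply: lspan_in; exists s.
  by rewrite addrC.
move: Hm; rewrite mcoeffXM; case: ifP => [le_m /IH <-|_]; last by rewrite eqxx.
by rewrite -{1}(submK le_m) addrA mon_wtD mon_wtU uv_wt_u [_ + wt i]addrC.
Qed.

Lemma act_graded i j m :
  graded_comp x wt (mon_wt m + (wt i + wt j)) (act x (com x i j) 'X_[m]).
Proof.
have Ci : C (com x i j) by apply: com_in.
elim/monomial_ind: m => [|k m IH].
  rewrite mon_wt0 add0r mpolyX0 act1; apply: subspaceB; first exact: lspan_subspace.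
    by apply: lspan_in; exists [:: i; j]; rewrite !big_cons !big_nil addr0 mulr1.
  by apply: lspan_in; exists [:: j; i]; rewrite !big_cons !big_nil addr0 mulr1 addrC.
rewrite mpolyXD act_var // mon_wtD mon_wtU -addrA /uv_wt /uv_op.
case: (split k) => l; first exact: graded_compMl.
apply: subspaceB; [exact: lspan_subspace | exact: graded_compMl|].
by rewrite addrC; apply: graded_compMr.
Qed.

Hypothesis charK : [pchar K] =i pred0.

(** The grading is pulled back from [Omega]: collect in [c2] the spanning elements of weight other
    than [k]. Its image has no part of weight [k], yet it is homogeneous of weight [k] as a
    difference, so it vanishes and injectivity gives [c2 = 0]. *)
Lemma phi_hom_inv k c : C c -> fox_hom k (phi c) -> graded_comp x wt k c.
Proof.
move=> Cc Hc; have [m [l [b [bC cE]]]] := comm_ideal_span sq0 xgen Cc.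
have /choice[kk bk] i : exists k', graded_comp x wt k' (b i) /\ C (b i).
  have [a1 [a2 [d ->]]] := bC i; exists (mon_wt d + (wt a1 + wt a2)).
  by split; [exact: act_graded | apply: act_in => //; apply: com_in].
pose c1 := \sum_(i | kk i == k) l i *: b i.
pose c2 := \sum_(i | kk i != k) l i *: b i.
have cD : c = c1 + c2 by rewrite cE (bigID (fun i => kk i == k)).
have G1 : graded_comp x wt k c1.
  apply: subspace_sum; first exact: lspan_subspace.
  by move=> i /eqP <-; apply: lspanZ; case: (bk i).
have C2 : C c2.
  apply: subspace_sum; first exact: comm_ideal_subspace.
  by move=> i _; apply: lspanZ; case: (bk i).
suff c20 : c2 = 0 by rewrite cD c20 addr0.
apply: (phi_inj charK sq0 xgen fox C2).
apply/ffunP => j; rewrite ffunE; apply/mpolyP => d; rewrite mcoeff0.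
have [dk|dk] := pselect (mon_wt d + wt j = k).
  rewrite /c2 linear_sum sum_ffunE raddf_sum big1 // => i /eqP ki.
  rewrite [phi _]linearZZ ffunE /= mcoeffZ; apply/eqP; rewrite mulf_eq0; apply/orP; right.
  apply/eqP; apply: contrapT => /eqP /(phi_hom (bk i).1) E.
  by apply: ki; rewrite -E.
have -> : c2 = c - c1 by rewrite cD addrC addKr.
rewrite linearB !ffunE mcoeffB.
have z0 (z : Omega) : fox_hom k z -> (z j)@_d = 0.
  by move=> Hz; apply/eqP; apply: contrapT => /negP /Hz.
by rewrite !z0 ?subr0 //; apply: phi_hom.
Qed.

End GradedComponents.
(** * Derivations *)

Section Derivations.
Variable K : fieldType.

Lemma derivation1 (B : algType K) (D : {linear B -> B}) : derivation D -> D 1 = 0.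
Proof.
move=> Dder; have := Dder 1 1; rewrite !mulr1 mul1r => E.
by apply: (@addrI _ (D 1)); rewrite addr0 -E.
Qed.

Variable n : nat.
Notation R := (uvpoly K n).
Notation Omega := {ffun 'I_n -> R}.

Definition uv_derivation (alpha : 'M[K]_n) (DP : {linear R -> R}) : Prop :=
  [/\ derivation DP, acts_by alpha (@u_gen K n) DP & acts_by alpha (@v_gen K n) DP].

Lemma uv_ind_gen (P : 'I_(n + n) -> Prop) :
  (forall i, P (lshift n i)) -> (forall i, P (rshift n i)) -> forall k, P k.
Proof. by move=> Pu Pv k; rewrite -[k]splitK; case: (split k). Qed.

Definition uvD_fun (alpha : 'M[K]_n) (f : R) : R :=
  \sum_j \sum_i alpha i j *: (u_gen K i * f^`M(lshift n j) + v_gen K i * f^`M(rshift n j)).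

Fact uvD_linear alpha : linear (uvD_fun alpha).
Proof.
move=> c f g; rewrite /uvD_fun scaler_sumr -big_split; apply: eq_bigr => j _ /=.
rewrite scaler_sumr -big_split; apply: eq_bigr => i _ /=.
rewrite !mderivD !mderivZ !mulrDr -!scalerAr addrACA -scalerDr [LHS]scalerDr.
by congr (_ + _); rewrite !scalerA mulrC.
Qed.

HB.instance Definition _ alpha :=
  GRing.isLinear.Build K R R _ (uvD_fun alpha) (uvD_linear alpha).

(** Needed for the polynomials in all [d] pairs of variables: the theorem supplies a derivation only
    for [d - 1] of them. *)
Lemma uvD_exists alpha : exists DP : {linear R -> R}, uv_derivation alpha DP.
Proof.
have dl (i j : 'I_n) : (u_gen K i)^`M(lshift n j) = (i == j)%:R.
  rewrite mderivX mnm1E eq_lshift; case: eqVneq => [->|_]; last by rewrite scale0r.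
  by rewrite scale1r -[X in (X - _)%MM]add0m addmK mpolyX0.
have dlr (i j : 'I_n) : (u_gen K i)^`M(rshift n j) = 0.
  by rewrite mderivX mnm1E eq_lrshift scale0r.
have drl (i j : 'I_n) : (v_gen K i)^`M(lshift n j) = 0.
  by rewrite mderivX mnm1E eq_rlshift scale0r.
exists (uvD_fun alpha); split.
- move=> f g /=; rewrite /uvD_fun mulr_suml mulr_sumr -big_split.
  apply: eq_bigr => j _ /=; rewrite mulr_suml mulr_sumr -big_split.
  apply: eq_bigr => i _ /=; rewrite !mderivM -scalerAl -scalerAr -scalerDr.
  by congr (_ *: _); ring.
- move=> j /=; rewrite /uvD_fun (bigD1 j) //= [X in _ + X]big1 => [|k /negPf kj].
    by rewrite addr0; apply: eq_bigr => i _; rewrite dl dlr eqxx mulr1 mulr0 addr0.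
  by rewrite big1 // => i _; rewrite dl dlr eq_sym kj !mulr0 addr0 scaler0.
move=> j /=; rewrite /uvD_fun (bigD1 j) //= [X in _ + X]big1 => [|k /negPf kj].
  by rewrite addr0; apply: eq_bigr => i _; rewrite drl mderiv_v eqxx mulr1 mulr0 add0r.
by rewrite big1 // => i _; rewrite drl mderiv_v kj !mulr0 addr0 scaler0.
Qed.

Variables (alpha : 'M[K]_n) (DP : {linear R -> R}).
Hypothesis DPuv : uv_derivation alpha DP.

(** The commutator of [d/dv_i] with [DP] is a derivation, determined by its values on the variables.
    Thus the gradient of [f] in the [v_i] transforms like the coordinates of a cycle under
    [fox_der_fun]. *)
Lemma mderiv_uv_derivation i f :
  (DP f)^`M(rshift n i) = DP f^`M(rshift n i) + \sum_j alpha i j *: f^`M(rshift n j).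
Proof.
have [DM Du Dv] := DPuv.
have dv0 (k j : 'I_n) : (u_gen K k)^`M(rshift n j) = 0.
  by rewrite mderivX mnm1E eq_lrshift scale0r.
move: f; apply: mpoly_alg_ind => [|c f g Ef Eg|k f Ef].
- rewrite derivation1 // -mpolyC1 !mderivC !linear0 add0r big1 // => j _.
  by rewrite mderivC scaler0.
- rewrite !linearD !linearZZ /= Ef Eg scalerDr addrACA; congr (_ + _).
  rewrite scaler_sumr -big_split; apply: eq_bigr => j _ /=.
  by rewrite !mderivD !mderivZ scalerDr !scalerA mulrC.
have DPnat (b : bool) : DP b%:R = 0.
  by case: b; rewrite ?linear0 // derivation1.
have hX : (DP 'X_k)^`M(rshift n i) =
    DP ('X_k)^`M(rshift n i) + \sum_j alpha i j *: ('X_k)^`M(rshift n j).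
  elim/uv_ind_gen: k => k.
    rewrite -/(u_gen K k) Du dv0 !linear0 add0r linear_sum !big1 // => j _.
      by rewrite /= ?mderivZ dv0 scaler0.
    by rewrite /= ?mderivZ dv0 scaler0.
  rewrite -/(v_gen K k) Dv mderiv_v DPnat add0r linear_sum.
  rewrite (bigD1 i) //= [X in _ + X]big1 => [|j /negPf ji]; last first.
    by rewrite /= mderivZ mderiv_v eq_sym ji scaler0.
  rewrite /= mderivZ mderiv_v eqxx addr0 (bigD1 k) //= [X in _ + X]big1 => [|j /negPf jk].
    by rewrite mderiv_v eqxx addr0.
  by rewrite mderiv_v jk scaler0.
rewrite DM mderivD !mderivM Ef hX linearD !DM.
have -> : \sum_j alpha i j *: ('X_k * f)^`M(rshift n j) =
    (\sum_j alpha i j *: ('X_k)^`M(rshift n j)) * f +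
    'X_k * (\sum_j alpha i j *: f^`M(rshift n j)).
  rewrite mulr_suml mulr_sumr -big_split; apply: eq_bigr => j _ /=.
  by rewrite mderivM scalerDr scalerAl scalerAr.
move: (\sum_j _) (\sum_j _) => S1 S2; ring.
Qed.

(** [DP] preserves the v-degree; in terms of Euler sums, the terms from [DP v_i] match those from
    [mderiv_uv_derivation]. *)
Lemma euler_uv_derivation f :
  vscale (fun e => e%:R) (DP f) = DP (vscale (fun e => e%:R) f).
Proof.
have [DM Du Dv] := DPuv; rewrite -!euler_vscale linear_sum.
under eq_bigr => i _ do rewrite mderiv_uv_derivation mulrDr.
under [RHS]eq_bigr => i _ do rewrite DM Dv.
rewrite !big_split /= addrC; congr (_ + _).
under eq_bigr => i _ do rewrite mulr_sumr.
under [RHS]eq_bigr => i _ do rewrite mulr_suml.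
rewrite exchange_big; apply: eq_bigr => j _; apply: eq_bigr => i _ /=.
by rewrite -scalerAr scalerAl.
Qed.

Lemma omega_subspace : subspace (uv_omega K n).
Proof. exact: lspan_subspace. Qed.

Lemma omega_v i f : uv_omega K n (v_gen K i * f).
Proof.
by apply: lspan_in; exists 1, (v_gen K i), f; split; [exists i | rewrite mul1r].
Qed.

(** Positivity of the v-degree on the support is what makes the Euler operator invertible on the
    ideal. *)
Lemma omega_vdeg f : uv_omega K n f <-> forall m, f@_m != 0 -> vdeg m != 0%N.
Proof.
split.
  move: f; apply: lspan_ind => [m|f g Hf Hg m|c _ [a [_ [b [[i _ <-] ->]]]] m].
  - by rewrite mcoeff0 eqxx.
  - by rewrite mcoeffD; have [->|/Hf//] := eqVneq f@_m 0; rewrite add0r; apply: Hg.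
  rewrite mulrAC mulrC mcoeffZ mcoeffXM; case: ifP => [le_m _|_]; last by rewrite mulr0 eqxx.
  by rewrite -(submK le_m) vdegD vdeg_v addn1.
move=> Hf; rewrite [f]mpolyE; apply: subspace_sum; first exact: omega_subspace.
move=> m _; have [->|/Hf] := eqVneq f@_m 0.
  by rewrite scale0r; case: omega_subspace.
rewrite sum_nat_eq0 => /forallPn[i]; rewrite implyTb => mi.
apply: (subspaceZ _ omega_subspace).
have -> : 'X_[m] = v_gen K i * 'X_[m - U_(rshift n i)] :> R.
  by rewrite -mpolyXD addmC submK // lep1mP.
exact: omega_v.
Qed.

Lemma omega_derivation f : uv_omega K n f -> uv_omega K n (DP f).
Proof.
have [DM Du Dv] := DPuv; have sO := omega_subspace.
move: f; apply: lspan_ind => [|f g Of Og|c _ [a [_ [b [[i _ <-] ->]]]]].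
- by rewrite linear0; case: sO.
- by rewrite linearD; apply: (subspaceD sO).
rewrite linearZZ; apply: (subspaceZ _ sO); rewrite mulrAC mulrC DM Dv.
apply: (subspaceD sO); last exact: omega_v.
rewrite mulr_suml; apply: (subspace_sum _ sO) => j _.
by rewrite -scalerAl; apply: (subspaceZ _ sO); apply: omega_v.
Qed.

(** Extends [DP] to the free module by letting the [t_j] transform like the [x_j], written in
    coordinates. *)
Definition fox_der_fun (z : Omega) : Omega :=
  [ffun i => DP (z i) + \sum_j alpha i j *: z j].

Fact fox_der_linear : linear fox_der_fun.
Proof.
move=> c y z; apply/ffunP => i; rewrite !ffunE linearD linearZZ scalerDr addrACA.
congr (_ + _); rewrite scaler_sumr -big_split; apply: eq_bigr => j _ /=.
by rewrite !ffunE scalerDr !scalerA mulrC.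
Qed.

HB.instance Definition _ :=
  GRing.isLinear.Build K Omega Omega _ fox_der_fun fox_der_linear.

Variables (B : algType K) (x : 'I_n -> B).
Variables (rhoU rhoW : {linear B -> R}) (phi : {linear B -> Omega}).
Variable D : {linear B -> B}.
Hypothesis xgen : alg_gen x.
Hypothesis fox : fox_calculus x rhoU rhoW phi.
Hypothesis Dder : derivation D.
Hypothesis Dx : acts_by alpha x D.

Lemma rhoW_derivation a : rhoW (D a) = DP (rhoW a).
Proof.
have [_ [WM W1 Wx] _] := fox; have [DM Du Dv] := DPuv.
move: a; apply: xgen => [|c a b Ea Eb|i a Ea].
- by rewrite W1 !derivation1 // linear0.
- by rewrite !linearD !linearZZ Ea Eb.
rewrite Dder linearD !WM DM Ea Wx; congr (_ * _ + _).
rewrite Dx linear_sum linearB /= Du Dv -sumrB; apply: eq_bigr => j _.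
by rewrite linearZZ Wx scalerBr.
Qed.

(** Together with injectivity on [C], this identifies the constants of [D] in [C] with the cycles
    killed by [fox_der_fun]. *)
Lemma phi_derivation a : phi (D a) = fox_der_fun (phi a).
Proof.
have [[UM U1 Ux] [WM W1 Wx] [phiM phix]] := fox; have [DM Du Dv] := DPuv.
move: a; apply: xgen => [|c a b Ea Eb|i a Ea].
- by rewrite derivation1 // (phi1 fox) !linear0.
- by rewrite !linearD !linearZZ Ea Eb.
apply/ffunP => j; rewrite Dder linearD !ffunE !phiM Ea !ffunE.
rewrite Ux phix rhoW_derivation linearD !DM Du.
have -> : rhoU (D (x i)) = \sum_k alpha k i *: u_gen K k.
  by rewrite Dx linear_sum; apply: eq_bigr => k _; rewrite linearZZ Ux.
have -> : phi (D (x i)) j = (alpha j i)%:MP.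
  rewrite Dx linear_sum sum_ffunE (bigD1 j) //= [X in _ + X]big1 => [|k /negPf kj].
    by rewrite linearZZ ffunE phix eqxx addr0 -alg_mpolyC.
  by rewrite linearZZ ffunE phix kj scaler0.
have -> : \sum_k alpha j k *: phi (x i * a) k =
    u_gen K i * (\sum_k alpha j k *: phi a k) + (alpha j i)%:MP * rhoW a.
  under eq_bigr => k _ do rewrite phiM Ux phix scalerDr.
  rewrite big_split mulr_sumr; congr (_ + _).
    by apply: eq_bigr => k _; rewrite scalerAr.
  rewrite (bigD1 i) //= [X in _ + X]big1 => [|k /negPf ki].
    by rewrite eqxx mul1r addr0 mul_mpolyC.
  by rewrite eq_sym ki mul0r scaler0.
have -> : DP (i == j)%:R = 0 by case: (i == j); rewrite ?linear0 // derivation1.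
move: (\sum_k _) (\sum_k _) => S1 S2; ring.
Qed.

End Derivations.
(** * Splitting off the last variable *)

Section LastVariable.
Variables (K : fieldType) (n : nat).
Notation R := (uvpoly K n).
Notation Rd := (uvpoly K n.+1).
Notation up := (@lift n.+1 ord_max).

Lemma big_lift_max (V : nmodType) (F : 'I_n.+1 -> V) :
  \sum_j F j = \sum_i F (up i) + F ord_max.
Proof.
rewrite big_ord_recr /=; congr (_ + _); apply: eq_bigr => i _; congr (F _).
by apply: val_inj; rewrite /= /bump leqNgt ltn_ord.
Qed.

Lemma up_ind (P : 'I_n.+1 -> Prop) : (forall i, P (up i)) -> P ord_max -> forall j, P j.
Proof. by move=> Pu Pm j; case: (unliftP ord_max j) => [i ->|->]. Qed.

(* The monomial [m] times [u_d^a v_d^b], where [d = n + 1]. *)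
Definition mon_ext (a b : nat) (m : 'X_{1..n + n}) : 'X_{1..n.+1 + n.+1} :=
  [multinom match split k with
            | inl j => if unlift ord_max j is Some i then m (lshift n i) else a
            | inr j => if unlift ord_max j is Some i then m (rshift n i) else b
            end | k < n.+1 + n.+1].

Definition mon_res (m : 'X_{1..n.+1 + n.+1}) : 'X_{1..n + n} :=
  [multinom match split k with
            | inl i => m (lshift n.+1 (up i))
            | inr i => m (rshift n.+1 (up i))
            end | k < n + n].

Lemma mon_ext_u a b m i : mon_ext a b m (lshift n.+1 (up i)) = m (lshift n i).
Proof. by rewrite mnmE (unsplitK (inl _)) liftK. Qed.

Lemma mon_ext_v a b m i : mon_ext a b m (rshift n.+1 (up i)) = m (rshift n i).
Proof. by rewrite mnmE (unsplitK (inr _)) liftK. Qed.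

Lemma mon_ext_ud a b m : mon_ext a b m (lshift n.+1 ord_max) = a.
Proof. by rewrite mnmE (unsplitK (inl _)) unlift_none. Qed.

Lemma mon_ext_vd a b m : mon_ext a b m (rshift n.+1 ord_max) = b.
Proof. by rewrite mnmE (unsplitK (inr _)) unlift_none. Qed.

Definition mon_extE := (mon_ext_u, mon_ext_v, mon_ext_ud, mon_ext_vd).

Lemma mon_ext_ind (P : 'I_(n.+1 + n.+1) -> Prop) :
    (forall i, P (lshift n.+1 (up i))) -> (forall i, P (rshift n.+1 (up i))) ->
    P (lshift n.+1 ord_max) -> P (rshift n.+1 ord_max) -> forall k, P k.
Proof.
by move=> Pu Pv Pud Pvd; apply: uv_ind_gen; apply: up_ind.
Qed.

Lemma mon_resE :
  (forall (m : 'X_{1..n.+1 + n.+1}) i, mon_res m (lshift n i) = m (lshift n.+1 (up i))) *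
  (forall (m : 'X_{1..n.+1 + n.+1}) i, mon_res m (rshift n i) = m (rshift n.+1 (up i))).
Proof. by split=> m i; rewrite mnmE ?(unsplitK (inl _)) ?(unsplitK (inr _)). Qed.

Lemma mon_extK a b : cancel (mon_ext a b) mon_res.
Proof. by move=> m; apply/mnmP; apply: uv_ind_gen => i; rewrite !mon_resE !mon_extE. Qed.

Lemma mon_resK (m : 'X_{1..n.+1 + n.+1}) :
  mon_ext (m (lshift n.+1 ord_max)) (m (rshift n.+1 ord_max)) (mon_res m) = m.
Proof. by apply/mnmP; apply: mon_ext_ind => [i|i||]; rewrite !mon_extE ?mon_resE. Qed.

Lemma mon_extD a b c d m m' :
  mon_ext (a + c) (b + d) (m + m') = (mon_ext a b m + mon_ext c d m')%MM.
Proof. by apply/mnmP; apply: mon_ext_ind => [i|i||]; rewrite !(mnmDE, mon_extE). Qed.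

Lemma mon_extU_u i : mon_ext 0 0 U_(lshift n i) = U_(lshift n.+1 (up i))%MM.
Proof.
apply/mnmP; apply: mon_ext_ind => [j|j||]; rewrite mon_extE !mnm1E ?eq_lshift ?eq_lrshift //.
- by rewrite (inj_eq (@lift_inj _ _)).
- by rewrite eq_sym (negPf (neq_lift _ _)).
Qed.

Lemma mon_extU_v i : mon_ext 0 0 U_(rshift n i) = U_(rshift n.+1 (up i))%MM.
Proof.
apply/mnmP; apply: mon_ext_ind => [j|j||]; rewrite mon_extE !mnm1E ?eq_rshift ?eq_rlshift //.
- by rewrite (inj_eq (@lift_inj _ _)).
- by rewrite eq_sym (negPf (neq_lift _ _)).
Qed.

Lemma mon_ext01 : mon_ext 0 1 0 = U_(rshift n.+1 ord_max)%MM.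
Proof.
apply/mnmP; apply: mon_ext_ind => [j|j||]; rewrite mon_extE !mnm1E ?mnm0E ?eq_rshift ?eq_rlshift
  ?eqxx //.
by rewrite (negPf (neq_lift _ _)).
Qed.

Lemma mon_ext10 : mon_ext 1 0 0 = U_(lshift n.+1 ord_max)%MM.
Proof.
apply/mnmP; apply: mon_ext_ind => [j|j||]; rewrite mon_extE !mnm1E ?mnm0E ?eq_lshift ?eq_lrshift
  ?eqxx //.
by rewrite (negPf (neq_lift _ _)).
Qed.

Definition uv_ext (a b : nat) : {linear R -> Rd} := lext (fun m => 'X_[mon_ext a b m]).

(** The coefficient of [u_d^a v_d^b], as a polynomial in the remaining variables. *)
Definition uv_coef (a b : nat) : {linear Rd -> R} :=
  lext (fun m => if (a == m (lshift n.+1 ord_max)) && (b == m (rshift n.+1 ord_max))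
                 then 'X_[mon_res m] else 0).

Lemma mcoeff_uv_coef a b h m : (uv_coef a b h)@_m = h@_(mon_ext a b m).
Proof.
have -> : h@_(mon_ext a b m) = \sum_(k <- msupp h) h@_k * (k == mon_ext a b m)%:R.
  by rewrite {1}[h]mpolyE raddf_sum; apply: eq_bigr => k _; rewrite /= mcoeffZ mcoeffX.
rewrite /uv_coef /= /lext raddf_sum; apply: eq_bigr => k _ /=; rewrite mcoeffZ.
congr (_ * _); case: (eqVneq k) => [->|kN].
  by rewrite !mon_extE !eqxx mon_extK mcoeffX eqxx.
case: ifP => [/andP[/eqP aE /eqP bE]|_]; last by rewrite mcoeff0.
rewrite mcoeffX; case: eqVneq => // resE; case/eqP: kN.
by rewrite -resE aE bE mon_resK.
Qed.

Lemma uv_coef_inj h h' : (forall a b, uv_coef a b h = uv_coef a b h') -> h = h'.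
Proof.
by move=> E; apply/mpolyP => m; rewrite -(mon_resK m) -!mcoeff_uv_coef E.
Qed.

Lemma uv_extX a b m : uv_ext a b 'X_[m] = 'X_[mon_ext a b m].
Proof. exact: lextX. Qed.

Lemma uv_coef_ext a b c d f :
  uv_coef a b (uv_ext c d f) = if (a == c) && (b == d) then f else 0.
Proof.
have E m : uv_coef a b (uv_ext c d 'X_[m]) = if (a == c) && (b == d) then 'X_[m] else 0.
  by rewrite uv_extX [LHS]lextX !mon_extE mon_extK.
case: ifP E => _ E.
  by apply: (@mpoly_linear_eq _ _ _ (uv_coef a b \o uv_ext c d) idfun).
by apply: (@mpoly_linear_eq _ _ _ (uv_coef a b \o uv_ext c d) \0).
Qed.

Lemma uv_extM a b c d f g : uv_ext (a + c) (b + d) (f * g) = uv_ext a b f * uv_ext c d g.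
Proof.
have E m : uv_ext (a + c) (b + d) ('X_[m] * g) = uv_ext a b 'X_[m] * uv_ext c d g.
  rewrite [g in LHS]mpolyE mulr_sumr linear_sum -[uv_ext c d g]/(\sum_(k <- msupp g) g@_k *: _).
  rewrite mulr_sumr; apply: eq_bigr => k _; rewrite -!scalerAr linearZZ; congr (_ *: _).
  by rewrite -mpolyXD !uv_extX mon_extD mpolyXD.
rewrite [f in LHS]mpolyE mulr_suml linear_sum -[uv_ext a b f]/(\sum_(k <- msupp f) f@_k *: _).
rewrite mulr_suml; apply: eq_bigr => k _; rewrite -!scalerAl linearZZ; congr (_ *: _).
by rewrite E uv_extX.
Qed.

Lemma uv_ext_u i : uv_ext 0 0 (u_gen K i) = u_gen K (up i).
Proof. by rewrite uv_extX mon_extU_u. Qed.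

Lemma uv_ext_v i : uv_ext 0 0 (v_gen K i) = v_gen K (up i).
Proof. by rewrite uv_extX mon_extU_v. Qed.

Lemma uv_ext01 : uv_ext 0 1 1 = v_gen K ord_max.
Proof. by rewrite -mpolyX0 uv_extX mon_ext01. Qed.

Lemma uv_ext10 : uv_ext 1 0 1 = u_gen K ord_max.
Proof. by rewrite -mpolyX0 uv_extX mon_ext10. Qed.

Lemma mul_v_ext i a b f : v_gen K (up i) * uv_ext a b f = uv_ext a b (v_gen K i * f).
Proof. by rewrite -uv_ext_v -uv_extM. Qed.

Lemma mul_vd_ext a b f : v_gen K ord_max * uv_ext a b f = uv_ext a b.+1 f.
Proof. by rewrite -uv_ext01 -uv_extM mul1r. Qed.

Lemma uv_coef_v i a b h : uv_coef a b (v_gen K (up i) * h) = v_gen K i * uv_coef a b h.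
Proof.
apply/mpolyP => m; rewrite mcoeff_uv_coef !mcoeffXM mcoeff_uv_coef.
rewrite !lep1mP mon_extE; case: eqP => //= /eqP mi; congr (_ @_ _).
have -> : mon_ext a b m = (mon_ext a b (m - U_(rshift n i)) + U_(rshift n.+1 (up i)))%MM.
  by rewrite -mon_extU_v -mon_extD !addn0 submK // lep1mP.
by rewrite addmK.
Qed.

Lemma uv_coef_vd a b h :
  uv_coef a b (v_gen K ord_max * h) = if b is b'.+1 then uv_coef a b' h else 0.
Proof.
apply/mpolyP => m; rewrite mcoeff_uv_coef mcoeffXM lep1mP mon_extE.
case: b => [|b]; rewrite ?mcoeff0 //= mcoeff_uv_coef; congr (_ @_ _).
have -> : mon_ext a b.+1 m = (mon_ext a b m + U_(rshift n.+1 ord_max))%MM.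
  by rewrite -mon_ext01 -mon_extD addn0 addn1 addm0.
by rewrite addmK.
Qed.

End LastVariable.
Section Triangle.
Variable k : nat.

(* The pairs of natural numbers of sum at most [k]. *)
Definition triangle := {l : 'I_k.+1 & 'I_l.+1}.

Definition tri_a (j : triangle) : nat := tagged j.
Definition tri_b (j : triangle) : nat := (tag j - tagged j)%N.

Lemma tri_ab j : (tri_a j + tri_b j)%N = tag j.
Proof. by rewrite subnKC // -ltnS ltn_ord. Qed.

Lemma tri_inj j j' : tri_a j = tri_a j' -> tri_b j = tri_b j' -> j = j'.
Proof.
move=> ea eb; have : tag j = tag j' by apply: val_inj; rewrite /= -!tri_ab ea eb.
move: ea; rewrite /tri_a {eb}; case: j => l i; case: j' => l' i' /= + ll'.
by rewrite -ll' in i' * => ea; congr existT; apply: val_inj.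
Qed.

Lemma sum_triangle (V : nmodType) (F : triangle -> V) j :
  \sum_i (if (tri_a j == tri_a i) && (tri_b j == tri_b i) then F i else 0) = F j.
Proof.
rewrite (bigD1 j) //= !eqxx big1 ?addr0 // => i ij; case: ifP => // /andP[/eqP ea /eqP eb].
by rewrite (tri_inj ea eb) eqxx in ij.
Qed.

Lemma sum_triangle2 (V : nmodType) (F : nat -> nat -> V) a b :
  \sum_i (if (a == tri_a i) && (b == tri_b i) then F (tri_a i) (tri_b i) else 0) =
  if (a + b <= k)%N then F a b else 0.
Proof.
case: ifP => ab; last first.
  apply: big1 => i _; case: ifP => // /andP[/eqP ea /eqP eb].
  by move: ab; rewrite ea eb tri_ab -ltnS ltn_ord.
have la : (a < (Ordinal (ab : (a + b < k.+1)%N)).+1)%N by rewrite ltnS leq_addr.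
pose j : triangle := existT _ (Ordinal (ab : (a + b < k.+1)%N)) (Ordinal la).
have ja : tri_a j = a by [].
have jb : tri_b j = b by rewrite /tri_b /= addKn.
by rewrite -{1}ja -{1}jb (sum_triangle (fun i => F (tri_a i) (tri_b i))) ja jb.
Qed.

End Triangle.

(** * The equivariant section *)

Section Decomposition.
Variables (K : fieldType) (n : nat).
Notation R := (uvpoly K n).
Notation Rd := (uvpoly K n.+1).
Notation Omega := {ffun 'I_n -> R}.
Notation Omegad := {ffun 'I_n.+1 -> Rd}.
Notation up := (@lift n.+1 ord_max).
Notation euler := (vscale (fun e => e%:R)).

Variables (alpha : 'M[K]_n.+1) (alpha' : 'M[K]_n).
Hypothesis alpha_up : forall i j, alpha (up i) (up j) = alpha' i j.
Hypothesis alpha_r : forall i, alpha ord_max i = 0.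
Hypothesis alpha_c : forall i, alpha i ord_max = 0.
Variables (DPd : {linear Rd -> Rd}) (DP : {linear R -> R}).
Hypothesis DPd_uv : uv_derivation alpha DPd.
Hypothesis DP_uv : uv_derivation alpha' DP.

Lemma derivation_ext a b f : DPd (uv_ext K n a b f) = uv_ext K n a b (DP f).
Proof.
have [DdM Ddu Ddv] := DPd_uv; have [DM Du Dv] := DP_uv.
have ud0 : DPd (u_gen K ord_max) = 0.
  by rewrite Ddu big1 // => i _; rewrite alpha_c scale0r.
have vd0 : DPd (v_gen K ord_max) = 0.
  by rewrite Ddv big1 // => i _; rewrite alpha_c scale0r.
move: f; apply: mpoly_alg_ind => [|c f g Ef Eg|k f Ef].
(* The case [f = 1]: [u_d^a v_d^b] is a constant, by induction on [a] and then on [b]. *)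
- rewrite derivation1 // linear0; elim: a => [|a IH]; last first.
    by rewrite -(add1n a) -(add0n b) -[1 in LHS]mulr1 uv_extM uv_ext10 DdM IH ud0 mul0r mulr0 addr0.
  elim: b => [|b IH]; first by rewrite -mpolyX0 uv_extX (_ : mon_ext _ _ _ = 0%MM) ?mpolyX0 ?derivation1 //;
    apply/mnmP; apply: mon_ext_ind => [i|i||]; rewrite mon_extE !mnm0E.
  by rewrite -(add1n b) -[X in uv_ext _ _ X](add0n 0) -[1 in LHS]mulr1 uv_extM uv_ext01 DdM IH vd0 mul0r mulr0 addr0.
- by rewrite !linearD !linearZZ Ef Eg.
have E g : uv_ext K n a b ('X_k * g) = uv_ext K n 0 0 'X_k * uv_ext K n a b g.
  by rewrite -uv_extM.
rewrite E DdM DM linearD E Ef; congr (_ + _).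
rewrite -[a in RHS]add0n -[b in RHS]add0n uv_extM; congr (_ * _).
elim/uv_ind_gen: k {E} => i.
  rewrite -/(u_gen K i) uv_ext_u Ddu Du big_lift_max alpha_r scale0r addr0 linear_sum.
  by apply: eq_bigr => j _; rewrite linearZZ uv_ext_u alpha_up.
rewrite -/(v_gen K i) uv_ext_v Ddv Dv big_lift_max alpha_r scale0r addr0 linear_sum.
by apply: eq_bigr => j _; rewrite linearZZ uv_ext_v alpha_up.
Qed.

(* [u_d^a v_d^b] times the sum of the cycle [fg.1] and of the section at [fg.2]. *)
Definition fox_split (a b : nat) (fg : (Omega * R)%type) : Omegad :=
  [ffun j => if unlift ord_max j is Some i
             then uv_ext K n a b (fg.1 i) - uv_ext K n a b.+1 (fg.2)^`M(rshift n i)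
             else uv_ext K n a b (euler fg.2)].

Fact fox_split_linear a b : linear (fox_split a b).
Proof.
move=> c f g; apply/ffunP => j.
have extP d e (y z : R) : uv_ext K n d e (c *: y + z) = c *: uv_ext K n d e y + uv_ext K n d e z.
  exact: linearP.
rewrite ffunE [RHS]ffunE ![(_ *: fox_split _ _ _) _]ffunE ![fox_split _ _ _ _]ffunE.
case: (unlift _ _) => [i|].
  rewrite (_ : (c *: f + g).1 i = c *: f.1 i + g.1 i); last by rewrite !ffunE.
  rewrite (mderivD _ (c *: f.2) g.2) (mderivZ _ c f.2) !extP.
  by rewrite opprD addrACA scalerBr.
by rewrite (linearP euler c f.2 g.2) extP.
Qed.

HB.instance Definition _ a b :=
  GRing.isLinear.Build K (Omega * R)%type Omegad _ (fox_split a b) (fox_split_linear a b).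

Lemma fox_split_up a b fg i : fox_split a b fg (up i) =
  uv_ext K n a b (fg.1 i) - uv_ext K n a b.+1 (fg.2)^`M(rshift n i).
Proof. by rewrite ffunE liftK. Qed.

Lemma fox_split_max a b fg : fox_split a b fg ord_max = uv_ext K n a b (euler fg.2).
Proof. by rewrite ffunE unlift_none. Qed.

Lemma uv_coef_split_up a b c d fg i : uv_coef K n c d (fox_split a b fg (up i)) =
  (if (c == a) && (d == b) then fg.1 i else 0) -
  (if (c == a) && (d == b.+1) then (fg.2)^`M(rshift n i) else 0).
Proof. by rewrite fox_split_up linearB /= !uv_coef_ext. Qed.

Lemma uv_coef_split_max a b c d fg : uv_coef K n c d (fox_split a b fg ord_max) =
  if (c == a) && (d == b) then euler fg.2 else 0.
Proof. by rewrite fox_split_max uv_coef_ext. Qed.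

(** By Euler's identity, the term [v_d E g] of the last coordinate cancels the sum of the
    [- v_i v_d dg/dv_i]. *)
Lemma fox_split_cycle a b fg : cycles fg.1 -> cycles (fox_split a b fg).
Proof.
rewrite /cycles /= => Zf; rewrite big_lift_max fox_split_max mul_vd_ext.
under eq_bigr => i _ do rewrite fox_split_up mulrBr !mul_v_ext.
rewrite sumrB -(linear_sum (uv_ext K n a b)) -(linear_sum (uv_ext K n a b.+1)) Zf.
by rewrite linear0 sub0r -euler_vscale addNr.
Qed.

Lemma fox_split_der a b fg :
  fox_der_fun alpha DPd (fox_split a b fg) =
  fox_split a b (fox_der_fun alpha' DP fg.1, DP fg.2).
Proof.
apply/ffunP; apply: up_ind => [i|]; rewrite ffunE big_lift_max.
  rewrite alpha_c scale0r addr0 !fox_split_up /= ffunE linearB /= !derivation_ext.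
  under eq_bigr => j _ do rewrite fox_split_up alpha_up scalerBr
    -(linearZZ (uv_ext K n a b)) -(linearZZ (uv_ext K n a b.+1)).
  rewrite sumrB -(linear_sum (uv_ext K n a b)) -(linear_sum (uv_ext K n a b.+1)).
  rewrite addrACA -opprD -(linearD (uv_ext K n a b)) -(linearD (uv_ext K n a b.+1)).
  by rewrite (mderiv_uv_derivation DP_uv).
rewrite alpha_r scale0r addr0 big1 => [|j _]; last by rewrite alpha_r scale0r.
by rewrite addr0 !fox_split_max derivation_ext /= (euler_uv_derivation DP_uv).
Qed.

End Decomposition.

(** * Homogeneous components of the constants *)

Section Spaces.
Variables (K : fieldType) (n : nat).
Notation R := (uvpoly K n).
Notation Omega := {ffun 'I_n -> R}.

(** Total degree and bidegree form one weight, so both gradings are handled by the same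
    statements. *)
Definition deg_wt (I : Type) (w : I -> nat * nat) (i : I) : (nat * (nat * nat))%type := (1%N, w i).

Variables (alpha : 'M[K]_n) (DP : {linear R -> R}) (w : 'I_n -> nat * nat).

Definition fox_space (k : nat * (nat * nat)) : set Omega :=
  [set z | [/\ cycles z, fox_der_fun alpha DP z = 0 & fox_hom (deg_wt w) k z]].

Definition uv_space (k : nat * (nat * nat)) : set R :=
  [set f | [/\ uv_omega K n f, DP f = 0 & uv_hom (deg_wt w) k f]].

Lemma cycles_subspace : subspace (@cycles K n).
Proof.
split=> [|c y z]; rewrite /cycles /=; first by rewrite big1 // => j _; rewrite ffunE mulr0.
move=> Zy Zz; under eq_bigr => j _ do rewrite !ffunE mulrDr -scalerAr.
by rewrite big_split -scaler_sumr /= Zy Zz scaler0 addr0.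
Qed.

Lemma fox_space_subspace k : subspace (fox_space k).
Proof.
have [c0 cD] := cycles_subspace; have [h0 hD] := fox_hom_subspace K (deg_wt w) k.
have [d0 dD] := subspace_ker (fox_der_fun alpha DP).
by split=> [|c y z [Zy Dy Hy] [Zz Dz Hz]]; [|split; auto; apply: dD].
Qed.

Lemma uv_space_subspace k : subspace (uv_space k).
Proof.
have [c0 cD] := @omega_subspace K n; have [h0 hD] := uv_hom_subspace K (deg_wt w) k.
have [d0 dD] := subspace_ker DP.
by split=> [|c y z [Zy Dy Hy] [Zz Dz Hz]]; [|split; auto; apply: dD].
Qed.

End Spaces.

Section MonWeight.
Variables (n : nat) (w : 'I_n.+1 -> nat * nat).
Hypothesis w_max : w ord_max = (0%N, 0%N).
Notation up := (@lift n.+1 ord_max).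

Lemma mon_wt_ext a b m : mon_wt (deg_wt w) (mon_ext a b m) =
  mon_wt (deg_wt (w \o up)) m + ((a + b)%N, (0%N, 0%N)).
Proof.
have E c : deg_wt w ord_max *+ c = (c, (0%N, 0%N)).
  rewrite /deg_wt w_max; elim: c => [|c IH] //.
  by rewrite mulrS IH.
have Eu (i : 'I_n) : uv_wt (deg_wt w) (lshift n.+1 (up i)) *+ mon_ext a b m (lshift n.+1 (up i)) =
    uv_wt (deg_wt (w \o up)) (lshift n i) *+ m (lshift n i).
  by rewrite !uv_wt_u mon_ext_u.
have Ev (i : 'I_n) : uv_wt (deg_wt w) (rshift n.+1 (up i)) *+ mon_ext a b m (rshift n.+1 (up i)) =
    uv_wt (deg_wt (w \o up)) (rshift n i) *+ m (rshift n i).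
  by rewrite !uv_wt_v mon_ext_v.
rewrite /mon_wt !big_split_ord !big_lift_max /= uv_wt_u uv_wt_v mon_ext_ud mon_ext_vd !E.
by rewrite (eq_bigr _ (fun i _ => Eu i)) (eq_bigr _ (fun i _ => Ev i)) addrACA.
Qed.

End MonWeight.

Lemma wtD (a b c d e f : nat) : (a, (b, c)) + (d, (e, f)) =
  ((a + d)%N, ((b + e)%N, (c + f)%N)) :> nat * (nat * nat).
Proof. by []. Qed.

Lemma natDE (a b : nat) : (a + b)%R = (a + b)%N.
Proof. by []. Qed.

(** * The direct sum decomposition of the constant cycles *)

Section SplitBasis.
Variables (K : fieldType) (n : nat).
Hypothesis charK : [pchar K] =i pred0.
Notation R := (uvpoly K n).
Notation Rd := (uvpoly K n.+1).
Notation Omega := {ffun 'I_n -> R}.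
Notation Omegad := {ffun 'I_n.+1 -> Rd}.
Notation up := (@lift n.+1 ord_max).
Notation euler := (vscale (fun e => e%:R)).

Variables (alpha : 'M[K]_n.+1) (alpha' : 'M[K]_n).
Hypothesis alpha_up : forall i j, alpha (up i) (up j) = alpha' i j.
Hypothesis alpha_r : forall i, alpha ord_max i = 0.
Hypothesis alpha_c : forall i, alpha i ord_max = 0.
Variables (DPd : {linear Rd -> Rd}) (DP : {linear R -> R}).
Hypothesis DPd_uv : uv_derivation alpha DPd.
Hypothesis DP_uv : uv_derivation alpha' DP.
Variables (w : 'I_n.+1 -> nat * nat) (w' : 'I_n -> nat * nat).
Hypothesis w_max : w ord_max = (0%N, 0%N).
Hypothesis w_up : forall i, w (up i) = w' i.
Variables (k : nat) (t : nat * nat).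
Notation wt := (mon_wt (deg_wt w')).

Let wt_ext a b m : mon_wt (deg_wt w) (mon_ext a b m) = wt m + ((a + b)%N, (0%N, 0%N)).
Proof.
rewrite mon_wt_ext //; congr (_ + _); apply: eq_bigr => i _; congr (_ *+ _).
by rewrite /uv_wt; case: (split i) => j; rewrite /deg_wt /= w_up.
Qed.

Lemma fox_hom_coef (z : Omegad) : fox_hom (deg_wt w) (k, t) z <->
  forall j a b m, (uv_coef K n a b (z j))@_m != 0 ->
    wt m + ((a + b)%N, (0%N, 0%N)) + deg_wt w j = (k, t).
Proof.
split=> H j.
  by move=> a b m; rewrite mcoeff_uv_coef => /H; rewrite wt_ext.
move=> m; rewrite -(mon_resK m) -mcoeff_uv_coef => /H.
by rewrite -wt_ext.
Qed.

(** The drop from [e] to [e'] is the degree of [t_d]; no nonzero [g] fits when no degree is left for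
    [t_d]. *)
Definition split_uv_space (e : nat) : set R :=
  if e is e'.+1 then uv_space DP w' (e', t) else [set g | g = 0].

Definition split_space (l : nat) : set (Omega * R)%type :=
  [set fg | fox_space alpha' DP w' ((k - l)%N, t) fg.1 /\ split_uv_space (k - l) fg.2].

Lemma fox_hom_shift l (f : Omega) : (l <= k)%N ->
  fox_hom (deg_wt w') ((k - l)%N, t) f <->
  forall i m, (f i)@_m != 0 -> wt m + (l, (0%N, 0%N)) + deg_wt w' i = (k, t).
Proof.
move=> lk; split=> H i m /H; rewrite /deg_wt; case: t {H} => t1 t2;
  case: (wt m) => q [q1 q2]; case: (w' i) => r1 r2; rewrite !wtD /= ?natDE => -[E <- <-].
  by congr (_, (_, _)); lia.
by congr (_, (_, _)); lia.
Qed.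

Lemma split_uv_spaceP l g : (l <= k)%N ->
  split_uv_space (k - l) g <-> [/\ uv_omega K n g, DP g = 0 &
    forall m, g@_m != 0 -> wt m + (l, (0%N, 0%N)) + (1%N, (0%N, 0%N)) = (k, t)].
Proof.
move=> lk; have [o0 _] := @omega_subspace K n.
have [kl|kl] := posnP (k - l).
  rewrite kl /=; split=> [->|[_ _ H]].
    by split; rewrite ?linear0 // => m; rewrite mcoeff0 eqxx.
  apply/mpolyP => m; rewrite mcoeff0; apply/eqP; apply: contrapT => /negP /H.
  by case: t => t1 t2; case: (wt m) => q [q1 q2]; rewrite !wtD /= ?natDE => -[]; lia.
rewrite -(prednK kl) /=; split=> -[Og Dg H]; split=> // m /H;
  case: t {H} => t1 t2; case: (wt m) => q [q1 q2]; rewrite !wtD /= ?natDE => -[].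
  by move=> -> -> ->; congr (_, (_, _)); lia.
by move=> qk <- <-; congr (_, (_, _)); lia.
Qed.

Lemma split_space_subspace l : subspace (split_space l).
Proof.
have [f0 fD] := fox_space_subspace alpha' DP w' ((k - l)%N, t).
have [g0 gD] : subspace (split_uv_space (k - l)).
  rewrite /split_uv_space; case: (k - l)%N => [|e]; last exact: uv_space_subspace.
  by split=> // c y z -> ->; rewrite scaler0 addr0.
by split=> // c y z [Fy Gy] [Fz Gz]; split; [apply: fD | apply: gD].
Qed.

Lemma euler_inj g : uv_omega K n g -> euler g = 0 -> g = 0.
Proof.
move/omega_vdeg => Og Eg; apply/mpolyP => m; rewrite mcoeff0; apply/eqP.
apply: contrapT => /negP gm; have := Og m gm; have := congr1 (mcoeff m) Eg.
rewrite mcoeff_vscale mcoeff0 => /eqP; rewrite mulf_eq0 (negPf gm) orbF.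
by rewrite ((pcharf0P K).1 charK) => ->.
Qed.

Notation T j := (@fox_split K n (tri_a j) (tri_b j)).

(** The system is triangular: the coefficient of [u_d^a v_d^b] in the last coordinate isolates one
    [euler g], and once all [g] vanish the other coordinates isolate the cycles. *)
Lemma fox_split_inj (fg : triangle k -> (Omega * R)%type) :
    (forall j, uv_omega K n (fg j).2) ->
  \sum_j T j (fg j) = 0 -> forall j, fg j = 0.
Proof.
move=> Og S0.
have g0 j : (fg j).2 = 0.
  apply: euler_inj => //; rewrite -(sum_triangle (fun j => euler (fg j).2) j).
  have := congr1 (fun z : Omegad => uv_coef K n (tri_a j) (tri_b j) (z ord_max)) S0.
  rewrite sum_ffunE linear_sum ffunE linear0 => E0; rewrite -[RHS]E0.
  by apply: eq_bigr => i _; rewrite uv_coef_split_max.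
move=> j; rewrite [fg j]surjective_pairing g0; congr pair; apply/ffunP => i.
rewrite ffunE -(sum_triangle (fun j => (fg j).1 i) j).
have := congr1 (fun z : Omegad => uv_coef K n (tri_a j) (tri_b j) (z (up i))) S0.
rewrite sum_ffunE linear_sum ffunE linear0 => E0; rewrite -[RHS]E0.
by apply: eq_bigr => l _; rewrite uv_coef_split_up g0 linear0 if_same subr0.
Qed.

Lemma fox_split_in a b fg : (a + b <= k)%N -> split_space (a + b) fg ->
  fox_space alpha DPd w (k, t) (fox_split a b fg).
Proof.
move=> abk [[Zf Df /(fox_hom_shift _ abk) Hf] /(split_uv_spaceP _ abk)[Og Dg Hg]].
split; first exact: fox_split_cycle.
  rewrite (fox_split_der alpha_up alpha_r alpha_c DPd_uv DP_uv) Df Dg.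
  exact: (linear0 (fox_split a b)).
apply/fox_hom_coef; apply: up_ind => [i|] c d m.
  rewrite uv_coef_split_up /deg_wt w_up mcoeffB.
  have [/andP[/eqP -> /eqP ->]|_] := boolP ((c == a) && (d == b)).
    by rewrite (ltn_eqF (ltnSn b)) andbF mcoeff0 subr0 => /Hf.
  (* What remains is the term in [v_d^(b+1)]: the additional [v_d] and [t_i] make up for the degrees
     of [v_i] lost by the derivative and of [t_d]. *)
  rewrite mcoeff0 sub0r oppr_eq0.
  case: ifP => [/andP[/eqP -> /eqP ->]|_]; last by rewrite mcoeff0 eqxx.
  rewrite mcoeff_deriv => gm.
  have /Hg : (fg.2)@_(m + U_(rshift n i)) != 0.
    by apply: contraNneq gm => ->; rewrite mul0rn.
  rewrite mon_wtD mon_wtU uv_wt_v => <-; rewrite /deg_wt.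
  case: (wt m) => q [q1 q2]; case: (w' i) => r1 r2.
  by rewrite !wtD /= ?natDE; congr (_, (_, _)); lia.
rewrite uv_coef_split_max; case: ifP => [/andP[/eqP -> /eqP ->]|_]; last by rewrite mcoeff0 eqxx.
rewrite mcoeff_vscale => gm.
have /Hg : (fg.2)@_m != 0 by apply: contraNneq gm => ->; rewrite mulr0.
by rewrite /deg_wt w_max.
Qed.

Section Existence.
Variable z : Omegad.
Hypothesis zW : fox_space alpha DPd w (k, t) z.

(** The inverse Euler operator; its value in v-degree 0 does not matter because of [coef_omega]. *)
Let gg a b : R := vscale (fun e => e%:R^-1) (uv_coef K n a b (z ord_max)).
(** The section at [gg a b'] contributes minus its gradient at [v_d^(b'+1)]; adding the gradient
    back leaves the cycle part. *)
Let ff a b : Omega := [ffun i => uv_coef K n a b (z (up i)) +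
  if b is b'.+1 then (gg a b')^`M(rshift n i) else 0].

Let z_cycle a b : \sum_i v_gen K i * uv_coef K n a b (z (up i)) =
  - (if b is b'.+1 then uv_coef K n a b' (z ord_max) else 0).
Proof.
have [Zz _ _] := zW; move: Zz; rewrite /cycles /= big_lift_max.
move/(congr1 (uv_coef K n a b)); rewrite linearD linear0 uv_coef_vd linear_sum.
move/eqP; rewrite addr_eq0 => /eqP <-; apply: eq_bigr => i _.
by rewrite uv_coef_v.
Qed.

(** The cycle relation at exponent [b.+1] of [v_d] writes this coefficient as minus a combination of
    the [v_i]. *)
Let coef_omega a b : uv_omega K n (uv_coef K n a b (z ord_max)).
Proof.
rewrite -[uv_coef _ _ _ _ _]opprK -(z_cycle a b.+1) -scaleN1r.
apply: (subspaceZ _ (@omega_subspace K n)); apply: (subspace_sum _ (@omega_subspace K n)).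
by move=> i _; apply: omega_v.
Qed.

Let euler_gg a b : euler (gg a b) = uv_coef K n a b (z ord_max).
Proof.
rewrite /gg (@vscale_comp _ _ _ _ (fun e => (e != 0%N)%:R)); last first.
  move=> m /(proj1 (omega_vdeg _) (coef_omega a b)) m0.
  by rewrite m0 divff // ((pcharf0P K).1 charK).
by apply: vscale1 => m /(proj1 (omega_vdeg _) (coef_omega a b)) ->.
Qed.

(** Every [t_j] has degree 1, which leaves a degree less than [k] for [u_d^a v_d^b]. *)
Let coef0 a b j : (k <= a + b)%N -> uv_coef K n a b (z j) = 0.
Proof.
have [_ _ /fox_hom_coef Hz] := zW; move=> kab; apply/mpolyP => m; rewrite mcoeff0.
apply/eqP; apply: contrapT => /negP /Hz; case: t => t1 t2.
by case: (wt m) => q [q1 q2]; rewrite /deg_wt; case: (w j) => r1 r2; rewrite !wtD /= ?natDE => -[]; lia.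
Qed.

Let split_z : z = \sum_(j : triangle k) T j (ff (tri_a j) (tri_b j), gg (tri_a j) (tri_b j)).
Proof.
apply/ffunP; apply: up_ind => [i|]; apply: uv_coef_inj => c d; rewrite sum_ffunE linear_sum.
  under eq_bigr => j _ do rewrite uv_coef_split_up.
  rewrite sumrB (sum_triangle2 k (fun a b => ff a b i)).
  have -> : \sum_(j : triangle k) (if (c == tri_a j) && (d == (tri_b j).+1)
                    then (gg (tri_a j) (tri_b j))^`M(rshift n i) else 0) =
      if d is d'.+1 then if (c + d' <= k)%N then (gg c d')^`M(rshift n i) else 0 else 0.
    case: d => [|d]; first by rewrite big1 // => j _; rewrite andbF.
    exact: (sum_triangle2 k (fun a b => (gg a b)^`M(rshift n i))).
  have gg0 a b : (k <= a + b)%N -> gg a b = 0.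
    by move=> kab; rewrite /gg coef0 // linear0.
  case: (leqP (c + d) k) => cd.
    rewrite ffunE; case: d cd => [|d] cd; first by rewrite addr0 subr0.
    by rewrite ifT ?addrK //; apply: leq_trans cd; rewrite leq_add2l.
  rewrite coef0 ?(ltnW cd) //; case: d cd => [|d] cd; first by rewrite subr0.
  by rewrite gg0 ?linear0 ?if_same ?subr0 // -ltnS -addnS.
under eq_bigr => j _ do rewrite uv_coef_split_max.
rewrite (sum_triangle2 k (fun a b => euler (gg a b))); case: leqP => cd; first by rewrite euler_gg.
by rewrite coef0 // ltnW.
Qed.

Let ff_cycle a b : cycles (ff a b).
Proof.
rewrite /cycles /=; under eq_bigr => i _ do rewrite ffunE mulrDr.
rewrite big_split /= z_cycle; case: b => [|b].
  by rewrite oppr0 add0r big1 // => i _; rewrite mulr0.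
by rewrite euler_vscale euler_gg addNr.
Qed.

Let gg_omega a b : uv_omega K n (gg a b).
Proof.
apply/omega_vdeg => m; rewrite mcoeff_vscale mulf_eq0 negb_or => /andP[_].
exact: (proj1 (omega_vdeg _) (coef_omega a b)).
Qed.

Lemma fox_split_onto : exists fg : triangle k -> (Omega * R)%type,
  (forall j : triangle k, split_space (tag j) (fg j)) /\ z = \sum_(j : triangle k) T j (fg j).
Proof.
exists (fun j : triangle k => (ff (tri_a j) (tri_b j), gg (tri_a j) (tri_b j))); split; last exact: split_z.
have [_ Dz /fox_hom_coef Hz] := zW.
(* By equivariance, deriving the decomposition of [z] gives a decomposition of 0, whose components
   vanish by [fox_split_inj]. *)
have D0 (j : triangle k) : (fox_der_fun alpha' DP (ff (tri_a j) (tri_b j)), DP (gg (tri_a j) (tri_b j))) = 0.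
  apply: (@fox_split_inj (fun j => (fox_der_fun alpha' DP (ff (tri_a j) (tri_b j)),
                                    DP (gg (tri_a j) (tri_b j))))) => [i|].
    exact: (omega_derivation DP_uv).
  rewrite -[RHS]Dz [in RHS]split_z (linear_sum (fox_der_fun alpha DPd)).
  apply: eq_bigr => i _.
  by rewrite [RHS](fox_split_der alpha_up alpha_r alpha_c DPd_uv DP_uv).
move=> j; have lk : (tag j <= k)%N by rewrite -ltnS ltn_ord.
have [Df Dg] : fox_der_fun alpha' DP (ff (tri_a j) (tri_b j)) = 0 /\ DP (gg (tri_a j) (tri_b j)) = 0.
  by have [-> ->] := D0 j.
have ghom a b m : (gg a b)@_m != 0 -> wt m + ((a + b)%N, (0%N, 0%N)) + (1%N, (0%N, 0%N)) = (k, t).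
  rewrite mcoeff_vscale mulf_eq0 negb_or => /andP[_ /Hz].
  by rewrite /deg_wt w_max.
split.
  split; [exact: ff_cycle | exact: Df |].
  apply/fox_hom_shift => // i m; rewrite -tri_ab /= ffunE mcoeffD /deg_wt -w_up.
  have [-> |/Hz //] := eqVneq (uv_coef K n (tri_a j) (tri_b j) (z (up i)))@_m 0.
  rewrite add0r; case: (tri_b j) => [|b]; first by rewrite mcoeff0 eqxx.
  rewrite mcoeff_deriv => gm.
  have /ghom : (gg (tri_a j) b)@_(m + U_(rshift n i)) != 0.
    by apply: contraNneq gm => ->; rewrite mul0rn.
  rewrite mon_wtD mon_wtU uv_wt_v /deg_wt w_up => <-.
  case: (wt m) => q [q1 q2]; case: (w' i) => r1 r2.
  by rewrite !wtD /= ?natDE; congr (_, (_, _)); lia.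
apply/split_uv_spaceP => //; split; [exact: gg_omega | exact: Dg |].
by move=> m /ghom <-; rewrite -tri_ab.
Qed.

End Existence.

Lemma fox_space_basis (A C : nat -> nat) :
    (forall l, has_basis (fox_space alpha' DP w' (l, t)) (A l)) ->
    (forall l, has_basis (uv_space DP w' (l, t)) (C l)) ->
  has_basis (fox_space alpha DPd w (k, t))
    (\sum_(l < k.+1) l.+1 * (A (k - l) + if k - l is e.+1 then C e else 0))%N.
Proof.
move=> HA HC; pose m l := (A (k - l) + if k - l is e.+1 then C e else 0)%N.
(* There are [l.+1] pairs [(a, b)] of sum [l]: the coefficient of [z^l] in [1 / (1 - z)^2]. *)
have -> : (\sum_(l < k.+1) l.+1 * m l = \sum_(j : triangle k) m (tag j))%N.
  rewrite -(@sig_big_dep _ _ _ _ (fun l : 'I_k.+1 => 'I_l.+1) predT (fun _ => predT)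
     (fun l _ => m l)) /=.
  by apply: eq_bigr => l _; rewrite sum_nat_const card_ord.
apply: (@has_basis_sum _ _ _ _ (fun=> (Omega * R)%type) (fun j : triangle k => split_space (tag j)) _
  (fun j => T j)).
- move=> j; apply: has_basis_prod => //.
  + exact: fox_space_subspace.
  + by rewrite /split_uv_space; case: (k - _)%N => [|e];
      [exact: (subspace_ker (@idfun R)) | exact: uv_space_subspace].
  by rewrite /split_uv_space; case: (k - _)%N => [|e]; [apply: has_basis0 | apply: HC].
- by move=> j; apply: split_space_subspace.
- move=> f Xf; apply: fox_split_inj => j; have lk : (tag j <= k)%N by rewrite -ltnS ltn_ord.
  by have [_ /(split_uv_spaceP _ lk)[]] := Xf j.
move=> z; split=> [/fox_split_onto[f []]|[f [Xf ->]]]; first by exists f.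
apply: (subspace_sum _ (fox_space_subspace _ _ _ _)) => j _.
by apply: fox_split_in; rewrite ?tri_ab // -ltnS ltn_ord.
Qed.

End SplitBasis.
(** * Hilbert series *)

Section HilbertDimensions.
Variable K : fieldType.

Lemma bihom_graded (B : algType K) (I : finType) (x : I -> B) (w : I -> nat * nat) n n1 n2 :
  bihom_comp x w n n1 n2 = graded_comp x (deg_wt w) (n, (n1, n2)).
Proof.
congr lspan; apply/seteqP.
have sumE (s : seq I) : \sum_(i <- s) deg_wt w i =
    (size s, (\sum_(i <- s) (w i).1, \sum_(i <- s) (w i).2)%N).
  elim: s => [|i s IH]; first by rewrite !big_nil.
  by rewrite !big_cons IH /deg_wt; case: (w i) => a b.
split=> v [s]; first by case=> <- <- <- ->; exists s; rewrite sumE.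
by rewrite sumE => -[[<- <- <-] ->]; exists s.
Qed.

(** With zero bidegrees the bigraded statements specialize to the total degree, so no summation over
    bidegrees is required. *)
Lemma hom_graded (B : algType K) (I : finType) (x : I -> B) n :
  hom_comp x n = graded_comp x (deg_wt (fun=> (0%N, 0%N))) (n, (0%N, 0%N)).
Proof.
rewrite -bihom_graded; congr lspan; apply/seteqP; split=> v [s].
  by case=> sn ->; exists s; split=> //; apply: big1.
by case=> sn _ _ ->; exists s.
Qed.

(** There are finitely many words of length [n]; this keeps [vdim] away from its junk value. *)
Lemma bihom_fin (B : algType K) (I : finType) (x : I -> B) (w : I -> nat * nat) n n1 n2 :
  exists N, exists e : 'I_N -> B, forall v, bihom_comp x w n n1 n2 v ->
    exists c : 'I_N -> K, v = \sum_j c j *: e j.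
Proof.
pose e (s : n.-tuple I) : B := \prod_(i <- s) x i.
exists #|{: n.-tuple I}|, (fun j => e (enum_val j)).
apply: lspan_min.
  split=> [|k u v [c ->] [d ->]].
    by exists (fun=> 0); rewrite big1 // => j _; rewrite scale0r.
  exists (fun j => k * c j + d j); rewrite scaler_sumr -big_split.
  by apply: eq_bigr => j _; rewrite scalerDl scalerA.
move=> _ [s [/eqP sn _ _ ->]]; pose j := enum_rank (Tuple sn).
exists (fun i => (i == j)%:R); rewrite (bigD1 j) //= eqxx scale1r [X in _ + X]big1 => [|i /negPf ->].
  by rewrite addr0 enum_rankK.
by rewrite scale0r.
Qed.

Lemma constants_subspace (B : algType K) (D : {linear B -> B}) (W : set B) :
  subspace W -> subspace (constants D W).
Proof. by move=> sW; apply: subspaceI => //; apply: subspace_ker. Qed.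

Lemma constants_basis (B : algType K) (I : finType) (x : I -> B) (w : I -> nat * nat)
    (D : {linear B -> B}) (W : set B) n n1 n2 : subspace W ->
  has_basis (constants D W `&` bihom_comp x w n n1 n2)
    (vdim (constants D W `&` bihom_comp x w n n1 n2)).
Proof.
move=> sW; have [N [e he]] := bihom_fin x w n n1 n2.
apply: (@has_basis_vdim _ _ _ N e) => [|v [_ /he //]].
by apply: subspaceI; [exact: constants_subspace | exact: lspan_subspace].
Qed.

Lemma uv_constants n (DP : {linear uvpoly K n -> uvpoly K n}) w k k1 k2 :
  constants DP (uv_omega K n) `&` bihom_comp (@uv_gen K n) (uv_gen_wt w) k k1 k2 =
  uv_space DP w (k, (k1, k2)).
Proof.
have -> : bihom_comp (@uv_gen K n) (uv_gen_wt w) k k1 k2 = uv_hom (deg_wt w) (k, (k1, k2)).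
  rewrite bihom_graded -uv_hom_graded; congr (graded_comp _ _ _).
  by apply/funext => -[].
by apply/seteqP; split=> f; [case=> -[] | case].
Qed.

Hypothesis charK : [pchar K] =i pred0.

Lemma metab_constants_basis n (alpha : 'M[K]_n) (D : {linear metab K n -> metab K n})
    (DP : {linear uvpoly K n -> uvpoly K n}) w k k1 k2 :
    derivation D -> acts_by alpha (@metab_gen K n) D -> uv_derivation alpha DP ->
  has_basis (fox_space alpha DP w (k, (k1, k2)))
    (vdim (constants D (metab' K n) `&` bihom_comp (@metab_gen K n) w k k1 k2)).
Proof.
move=> Dder Dx DPuv; have [rhoU [rhoW [phi fox]]] := metab_fox K n.
have gen := @metab_gen_ind K n; have sq0 := @metab_comm_sq0 K n.
have sC : subspace (metab' K n) by apply: comm_ideal_subspace.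
have phiD := phi_derivation DPuv gen fox Dder Dx.
have inj := phi_inj charK sq0 gen fox.
apply: (has_basis_image (T := phi) _ _ _ (constants_basis _ _ _ _ _ _ sC)).
- by apply: subspaceI; [exact: constants_subspace | exact: lspan_subspace].
- by move=> c [[Cc _] _]; apply: inj.
rewrite bihom_graded => z; split=> [[Zz Dz Hz]|[c [[Cc Dc] Gc] <-]]; last first.
  split; [exact: (phi_cycle sq0 gen fox) | | exact: (phi_hom fox)].
  by rewrite -phiD Dc linear0.
have [c Cc cz] := phi_onto charK sq0 fox Zz.
exists c => //; split; last by apply: (phi_hom_inv sq0 gen fox charK) => //; rewrite cz.
(* [D c] stays in the commutator ideal, so it is zero as soon as its image is. *)
split=> //=; apply: inj; first exact: comm_ideal_derivation.
by rewrite phiD cz.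
Qed.

Notation up := (@lift _ ord_max).

Lemma vdim_split n (alpha : 'M[K]_n.+1) (alpha' : 'M[K]_n)
    (D : {linear metab K n.+1 -> metab K n.+1}) (D' : {linear metab K n -> metab K n})
    (DP : {linear uvpoly K n -> uvpoly K n})
    (w : 'I_n.+1 -> nat * nat) (w' : 'I_n -> nat * nat) k k1 k2 :
    (forall i j, alpha (up i) (up j) = alpha' i j) -> (forall i, alpha ord_max i = 0) ->
    (forall i, alpha i ord_max = 0) -> w ord_max = (0%N, 0%N) ->
    (forall i, w (up i) = w' i) ->
    derivation D -> acts_by alpha (@metab_gen K n.+1) D ->
    derivation D' -> acts_by alpha' (@metab_gen K n) D' -> uv_derivation alpha' DP ->
  vdim (constants D (metab' K n.+1) `&` bihom_comp (@metab_gen K n.+1) w k k1 k2) =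
  (\sum_(l < k.+1) l.+1 *
    (vdim (constants D' (metab' K n) `&` bihom_comp (@metab_gen K n) w' (k - l) k1 k2) +
     if k - l is e.+1
     then vdim (constants DP (uv_omega K n) `&`
                bihom_comp (@uv_gen K n) (uv_gen_wt w') e k1 k2) else 0))%N.
Proof.
move=> aup ar ac wm wu Dd Dx D'd D'x DPuv.
have [DPd DPduv] := uvD_exists alpha.
(* [B1] and [B2] are bases of the same space of constant cycles; comparing their sizes gives the
   formula. *)
have B1 := metab_constants_basis w k k1 k2 Dd Dx DPduv.
have B2 := fox_space_basis charK aup ar ac DPduv DPuv wm wu k (t := (k1, k2))
  (fun l => metab_constants_basis w' l k1 k2 D'd D'x DPuv) (C := fun l => vdim (uv_space DP w' (l, (k1, k2)))).
have : has_basis (fox_space alpha DPd w (k, (k1, k2)))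
  (vdim (fox_space alpha DPd w (k, (k1, k2)))) by rewrite (vdimE B1).
rewrite -(vdimE B1) (vdimE (B2 _)) => [_|l].
  apply: eq_bigr => l _; congr (_ * (_ + _))%N.
  by case: (k - l)%N => // e; rewrite uv_constants.
by rewrite -uv_constants; apply: constants_basis; apply: omega_subspace.
Qed.

End HilbertDimensions.

(** * Jordan types with an appended cell of size 1 *)

Section AppendTrivialCell.
Variable p : seq nat.
Notation q := (rcons p 0%N).

Lemma jdim_rcons : jdim q = (jdim p).+1.
Proof. by rewrite /jdim /jsizes map_rcons sumn_rcons addn1. Qed.

Lemma jcell_lt i : (i < jdim p)%N -> (jcell p i < size p)%N.
Proof. by move=> /reshape_indexP; rewrite /jsizes size_map. Qed.

Lemma jcell_jpos_rcons i : (i < jdim p)%N -> jcell q i = jcell p i /\ jpos q i = jpos p i.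
Proof.
move=> ip; pose sh := jsizes p; have rs := reshape_indexP ip.
(* The flat index depends only on the sizes of the preceding cells, which the appended cell does not
   change. *)
have E : flatten_index (rcons sh 1%N) (jcell p i) (jpos p i) = i.
  rewrite -[RHS](reshape_indexK sh i) /flatten_index -cats1 takel_cat //.
  exact: ltnW.
have lt : (jpos p i < nth 0 (rcons sh 1) (jcell p i))%N.
  by rewrite nth_rcons rs; apply: reshape_offsetP.
rewrite /jcell /jpos /jsizes map_rcons -/(jsizes p) -/sh -[in reshape_index (rcons _ _) _]E.
by rewrite -[in reshape_offset (rcons _ _) _]E flatten_indexKl ?flatten_indexKr.
Qed.

Lemma jcell_jpos_last : jcell q (jdim p) = size p /\ jpos q (jdim p) = 0%N.
Proof.
pose sh := jsizes p.
have E : flatten_index (rcons sh 1%N) (size sh) 0 = jdim p.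
  by rewrite /flatten_index -cats1 take_size_cat // addn0.
have lt : (0 < nth 0 (rcons sh 1) (size sh))%N by rewrite nth_rcons ltnn eqxx.
rewrite /jcell /jpos /jsizes map_rcons -/(jsizes p) -/sh -E.
by rewrite flatten_indexKl ?flatten_indexKr // size_map.
Qed.

Lemma jbideg_rcons i : (i < jdim p)%N -> jbideg q i = jbideg p i.
Proof.
move=> ip; have [ec eo] := jcell_jpos_rcons ip.
by rewrite /jbideg ec eo nth_rcons jcell_lt.
Qed.

Lemma jbideg_last : jbideg q (jdim p) = (0%N, 0%N).
Proof. by have [ec eo] := jcell_jpos_last; rewrite /jbideg ec eo nth_rcons ltnn eqxx. Qed.

Variable K : fieldType.

Lemma jordan_mx_rcons (i j : 'I_(jdim q)) (i' j' : 'I_(jdim p)) :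
  i = i' :> nat -> j = j' :> nat -> jordan_mx K q i j = jordan_mx K p i' j'.
Proof.
move=> ii jj; rewrite !mxE ii jj.
by have [-> ->] := jcell_jpos_rcons (ltn_ord i'); have [-> ->] := jcell_jpos_rcons (ltn_ord j').
Qed.

(** The last generator is alone in its cell and its offset 0 does not succeed itself, so its row and
    column vanish. *)
Lemma jordan_mx_last (i j : 'I_(jdim q)) :
  i = jdim p :> nat \/ j = jdim p :> nat -> jordan_mx K q i j = 0.
Proof.
have lt (k : 'I_(jdim q)) : k = jdim p :> nat \/ (k < jdim p)%N.
  by have := ltn_ord k; rewrite {2}jdim_rcons ltnS leq_eqVlt => /orP[/eqP|]; [left | right].
have [lc lo] := jcell_jpos_last.
have H (k : 'I_(jdim q)) : k != jdim p :> nat -> (jcell q k < size p)%N.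
  move=> /eqP kp; case: (lt k) => // kp'.
  by have [-> _] := jcell_jpos_rcons kp'; apply: jcell_lt.
rewrite mxE; have [->|/H ni] := eqVneq (i : nat) (jdim p); rewrite ?lc ?lo.
  have [->|/H nj] := eqVneq (j : nat) (jdim p); first by rewrite lo andbF.
  by rewrite (gtn_eqF nj).
have [->|/H nj] := eqVneq (j : nat) (jdim p); first by rewrite lc (ltn_eqF ni).
case=> E; first by rewrite E lc ltnn in ni.
by rewrite E lc ltnn in nj.
Qed.

End AppendTrivialCell.

(** * Coefficients of the right-hand side *)

Section PowerSeriesCoefficients.
Variable R : comNzRingType.

Lemma fpscoefD (f g : fps R) n : fpscoef (f + g) n = fpscoef f n + fpscoef g n.
Proof. by []. Qed.

Lemma fpscoef_inv_sq1BZ (f g : fps R) n :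
  fpscoef ((1 - 'z) ^- 2 * (f + 'z * g)) n =
  \sum_(l < n.+1) (fpscoef f (n - l)%N + if (n - l)%N is e.+1 then fpscoef g e else 0) *+ l.+1.
Proof.
rewrite fps_inv_sq1BZ; apply: eq_bigr => l _.
by rewrite fpscoefD coef_fpsZM.
Qed.

(** For the nested series: a coefficient in [z] is itself a sum of series in [t1] and [t2], from
    which coefficients are taken again. *)
Lemma fpscoef_sumMn (I : Type) (r : seq I) (F : I -> fps R) (c : I -> nat) n :
  fpscoef (\sum_(i <- r) F i *+ c i) n = \sum_(i <- r) fpscoef (F i) n *+ c i.
Proof.
elim/big_rec2: _ => // i x y _ <-; rewrite fpscoefD; congr (_ + _).
by elim: (c i) => // m IH; rewrite !mulrS fpscoefD IH.
Qed.

End PowerSeriesCoefficients.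

(** * The dimension formula for Jordan types *)

Section VdimSplitJordan.
Variable K : fieldType.
Hypothesis charK : [pchar K] =i pred0.
Variable p : seq nat.
Notation N := (jdim (rcons p 0%N)).
Notation n := (jdim p).

Lemma vdim_split_jordan (D : {linear metab K N -> metab K N})
    (D' : {linear metab K n -> metab K n}) (DP : {linear uvpoly K n -> uvpoly K n})
    (w : nat -> nat * nat) (w' : nat -> nat * nat) k k1 k2 :
    w n = (0%N, 0%N) -> (forall i, (i < n)%N -> w i = w' i) ->
    metab_weitzenboeck D -> metab_weitzenboeck D' -> uv_weitzenboeck DP ->
  vdim (constants D (metab' K N) `&` bihom_comp (@metab_gen K N) (fun j => w j) k k1 k2) =
  (\sum_(l < k.+1) l.+1 *
    (vdim (constants D' (metab' K n) `&` bihom_comp (@metab_gen K n) (fun j => w' j) (k - l) k1 k2) +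
     if k - l is e.+1
     then vdim (constants DP (uv_omega K n) `&`
                bihom_comp (@uv_gen K n) (uv_gen_wt (fun j => w' j)) e k1 k2) else 0))%N.
Proof.
move=> wn ww' [Dd Dx] [D'd D'x] DPuv.
have aup := @jordan_mx_rcons p K; have alast := @jordan_mx_last p K.
(* [N] equals [n.+1] only propositionally, so everything whose type mentions it is generalized
   before rewriting. This is also why the weights are functions on [nat]. *)
move: (jordan_mx K (rcons p 0%N)) aup alast D Dd Dx; rewrite jdim_rcons.
move=> alpha aup alast D Dd Dx.
apply: (@vdim_split K charK n alpha (jordan_mx K p) D D' DP (fun j => w j) (fun j => w' j)) => //.
- by move=> i j; apply: aup; apply: lift_max.
- by move=> i; apply: alast; left.
- by move=> i; apply: alast; right.
by move=> i; rewrite -ww' //; congr (w _); exact: lift_max.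
Qed.

Lemma sum_Posz k (G : nat -> nat) :
  (\sum_(l < k.+1) l.+1 * G (k - l))%N%:Z = \sum_(l < k.+1) (G (k - l)%N)%:Z *+ l.+1.
Proof.
rewrite (big_morph Posz PoszD (erefl 0%:Z)); apply: eq_bigr => l _.
by rewrite PoszM -mulr_natl natz.
Qed.

End VdimSplitJordan.

Theorem lemma4p1 (K : fieldType) (charK : [pchar K] =i pred0)
    (p : seq nat) (p_sorted : sorted geq p) (p_neq0 : has (leq 1) p)
    (D : {linear metab K (jdim (rcons p 0%N)) -> metab K (jdim (rcons p 0%N))})
    (D' : {linear metab K (jdim p) -> metab K (jdim p)})
    (DP : {linear uvpoly K (jdim p) -> uvpoly K (jdim p)}) :
  metab_weitzenboeck D -> metab_weitzenboeck D' -> uv_weitzenboeck DP ->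
  metab_hilbGL2 (constants D (metab' K (jdim (rcons p 0%N)))) =
    (1 - 'z) ^- 2 *
      (metab_hilbGL2 (constants D' (metab' K (jdim p))) +
       'z * uv_hilbGL2 (constants DP (uv_omega K (jdim p))))
  /\
  metab_hilb (constants D (metab' K (jdim (rcons p 0%N)))) =
    (1 - 'z) ^- 2 *
      (metab_hilb (constants D' (metab' K (jdim p))) +
       'z * uv_hilb (constants DP (uv_omega K (jdim p)))).
Proof.
move=> WD WD' WDP; pose n := jdim p.
pose VA w k k1 k2 := vdim (constants D' (metab' K n) `&`
  bihom_comp (@metab_gen K n) (fun j => w (j : nat)) k k1 k2).
pose VB w k k1 k2 := vdim (constants DP (uv_omega K n) `&`
  bihom_comp (@uv_gen K n) (uv_gen_wt (fun j => w (j : nat))) k k1 k2).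
(* The shift from [e.+1] to [e] is the factor [z] before the second series. *)
pose V w k1 k2 k := (VA w k k1 k2 + if k is e.+1 then VB w e k1 k2 else 0)%N.
split; apply: fpsP => k.
  apply: fpsP => k1; apply: fpsP => k2.
  apply: (etrans (congr1 Posz (vdim_split_jordan charK k k1 k2 (jbideg_last p)
    (@jbideg_rcons p) WD WD' WDP))).
  apply: (etrans (sum_Posz k (V (jbideg p) k1 k2))).
  rewrite fpscoef_inv_sq1BZ !fpscoef_sumMn; apply: eq_bigr => l _; congr (_ *+ _).
  by rewrite !fpscoefD /V PoszD; case: (k - l)%N.
have hom0 (B : algType K) (I : finType) (x : I -> B) m :
    hom_comp x m = bihom_comp x (fun=> (0%N, 0%N)) m 0 0.
  by rewrite hom_graded bihom_graded.
pose w0 (i : nat) := (0%N, 0%N).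
have uvw0 : uv_gen_wt (fun j : 'I_n => w0 j) = (fun=> (0%N, 0%N)).
  by apply/funext => -[].
rewrite fpscoef_inv_sq1BZ -[LHS]/(Posz (vdim _)) hom0.
apply: (etrans (congr1 Posz (vdim_split_jordan charK k 0 0 (w := w0) (w' := w0) erefl
  (fun _ _ => erefl) WD WD' WDP))).
apply: (etrans (sum_Posz k (V w0 0 0))).
apply: eq_bigr => l _; congr (_ *+ _); rewrite /V PoszD /VA /metab_hilb /= hom0.
by case: (k - l)%N => //= e; rewrite hom0 /VB uvw0.
Qed.
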